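(* Let $k\ge 3$. If a $k$-partite $k$-graph $F$ satisfies $\gcd(\mathcal{S}(F))=1$, then $F\in\mathbf{FACTOR}_k^{\cdot,k-1}$. Moreover, if $F$ is a complete $k$-partite $k$-graph, then $F\in\mathbf{FACTOR}_k^{\cdot,k-1}$ if and only if $\gcd(\mathcal{S}(F))=1$.
   Context: A $k$-graph $H=(V(H),E(H))$ has edge set $E(H)\subseteq\binom{V(H)}{k}$; $\delta_{k-1}(H)$ is the minimum, over all $(k-1)$-subsets $S$ of $V(H)$, of the number of edges containing $S$. An $F$-factor in $H$ is a set of vertex-disjoint copies of $F$ covering $V(H)$. A $k$-partite realisation of a $k$-graph $F$ is a partition of $V(F)$ into classes $V_1,\dots,V_k$ such that $|e\cap V_i|=1$ for all $e\in E(F)$, $i\in[k]$; $F$ is $k$-partite if it has one. $\mathcal{S}(F)=\bigcup_\chi\{|V_1|,\dots,|V_k|\}$, the union over all $k$-partite realisations $\chi=(V_1,\dots,V_k)$ of $F$. The complete $k$-partite $k$-graph $K_{a_1,\dots,a_k}$ has vertex classes of sizes $a_1,\dots,a_k$ and all $k$-sets meeting each class once as edges. An $(n,p,\mu,\cdot)$ $k$-graph is a $k$-graph $H$ on a vertex set $V$ with $|V|=n$ such that for all $X_1,\dots,X_k\subseteq V$, the number of $k$-tuples $(x_1,\dots,x_k)\in X_1\times\cdots\times X_k$ with $\{x_1,\dots,x_k\}\in E(H)$ is at least $p|X_1|\cdots|X_k|-\mu n^k$. $\mathbf{FACTOR}_k^{\cdot,k-1}$ is the class of $k$-graphs $F$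 such that for all $0<p,\alpha<1$ there exist $n_0$ and $\mu>0$ such that every $(n,p,\mu,\cdot)$ $k$-graph $H$ with $\delta_{k-1}(H)\ge\alpha n$, $n\ge n_0$ and $v(F)\mid n$ has an $F$-factor. *)

(* Defs.v *)
From Stdlib Require Import Reals.
From mathcomp Require Import all_boot.
Set Implicit Arguments.
Unset Strict Implicit.
Unset Printing Implicit Defensive.

Definition uniform (k : nat) (V : finType) (E : {set {set V}}) : Prop :=
  forall e, e \in E -> #|e| = k.

Definition min_codeg_ge (k : nat) (V : finType) (E : {set {set V}}) (a : R) : Prop :=
  forall S : {set V}, #|S| = k.-1 -> Rle a (INR #|[set e in E | S \subset e]|).

Definition unif_dense (k : nat) (V : finType) (E : {set {set V}}) (p mu : R) : Prop :=
  forall X : 'I_k -> {set V},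
    Rle (Rminus (Rmult p (INR (\prod_(i < k) #|X i|))) (Rmult mu (INR (#|V| ^ k))))
        (INR #|[set x : {ffun 'I_k -> V} |
                 [forall i, x i \in X i] && ([set x i | i : 'I_k] \in E)]|).

Definition is_copy (VF V : finType) (EF : {set {set VF}}) (E : {set {set V}})
  (phi : VF -> V) : Prop :=
  injective phi /\ forall e, e \in EF -> phi @: e \in E.

Definition has_factor (VF V : finType) (EF : {set {set VF}}) (E : {set {set V}}) : Prop :=
  exists (m : nat) (phi : 'I_m -> VF -> V),
    (forall j, is_copy EF E (phi j)) /\
    (forall j1 j2 x1 x2, phi j1 x1 = phi j2 x2 -> j1 = j2) /\
    (forall v, exists j x, phi j x = v).

Definition FACTOR (k : nat) (VF : finType) (EF : {set {set VF}}) : Prop :=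
  forall p alpha : R, Rlt 0 p -> Rlt p 1 -> Rlt 0 alpha -> Rlt alpha 1 ->
  exists (n0 : nat) (mu : R), Rlt 0 mu /\
    forall (V : finType) (E : {set {set V}}),
      uniform k E -> unif_dense k E p mu ->
      min_codeg_ge k E (Rmult alpha (INR #|V|)) ->
      n0 <= #|V| -> #|VF| %| #|V| ->
      has_factor EF E.

Definition realisation (k : nat) (VF : finType) (EF : {set {set VF}})
  (c : {ffun VF -> 'I_k}) : bool :=
  [forall e in EF, forall i : 'I_k, #|[set x in e | c x == i]| == 1].

Definition kpartite (k : nat) (VF : finType) (EF : {set {set VF}}) : Prop :=
  exists c : {ffun VF -> 'I_k}, realisation EF c.

Definition inS (k : nat) (VF : finType) (EF : {set {set VF}}) (s : nat) : bool :=
  [exists c : {ffun VF -> 'I_k},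
     realisation EF c && [exists i : 'I_k, #|[set x | c x == i]| == s]].

(* gcd(S(F)); all elements of S(F) are <= #|VF|. gcd of the empty set is 0. *)
Definition gcdS (k : nat) (VF : finType) (EF : {set {set VF}}) : nat :=
  \big[gcdn/0]_(s < #|VF|.+1 | inS k EF s) (s : nat).

Definition Kvert (k : nat) (a : 'I_k -> nat) : finType := {i : 'I_k & 'I_(a i)}.

Definition Kedges (k : nat) (a : 'I_k -> nat) : {set {set Kvert a}} :=
  [set e : {set Kvert a} | [forall i : 'I_k, #|[set x in e | tag x == i]| == 1]].

(* Main.v *)
Require Import Defs.
From Stdlib Require Import Reals Lra.
From mathcomp Require Import all_boot fingroup perm zify.
Set Implicit Arguments.
Unset Strict Implicit.
Unset Printing Implicit Defensive.

(** Uniform density says nothing about a single vertex, while exchanging concerns single vertices.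
    The codegree condition closes this gap: it attaches to each vertex a linear set [Z] whose
    members can be exchanged with it, and density can act on such sets. The sizes in S(F) matter
    themselves, not only their differences, because two copies of F are compared: one with its first
    class in [Z'] and the rest in [Z], the other inside [Z]. Each has an F-factor alone, so they
    cancel, and a trade of |V_i| vertices remains. Proportions are kept as natural reciprocals ([b]
    stands for 1/b), so that the combinatorics is integer arithmetic; real numbers enter only when
    the density and codegree hypotheses are translated. In the necessity part the order n^(k-1) of
    random bits has to beat the 2^(nk) choices of X_1, ..., X_k, which is where k >= 3 is needed.
    Potential edges share bits, so the k-sets are split by the sum of their elements mod n, and a
    Chernoff-type bound is applied to each part. *)

(** Sufficiency. For every vertex w, dependent random choice (available because
of the codegree condition) gives a linear set Z of vertices any two of which can
be exchanged in many ways: z and z' are exchangeable when S + z and S + z' have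
F-factors for a positive proportion of the bounded-size sets S. Copies of F whose
i-th class lies in Z, or alternatively in Z', show that |V_i| vertices of Z
can be traded for |V_i| vertices of Z'. The set of tradable numbers is closed under
differences, hence under gcd, so gcd(S(F)) = 1 makes all pairs of vertices exchangeable.
This yields a positive density of absorbers for every |V(F)|-set; a linear family
of disjoint absorbers is selected by a potential function, the remaining vertices are
tiled greedily by uniform density, and the leftover is absorbed.

Necessity. Split the vertices into two sides and choose for every (k-1)-set S
at random the side that is allowed to extend it; the edges are the k-sets e with
every x in e on the side allowed for e - x. All vertices of a class of a copy of
K_{a_1,...,a_k} are then on the same side, so a common divisor of the a_i divides
the size of a side if there is a factor. *)

(** * Sums over lists and nested positive proportion *)

Section ManyTheory.
Variable V : finType.
Implicit Types (P Q : seq V -> bool) (F G : seq V -> nat).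

Fixpoint Sum (s : nat) F : nat :=
  if s is s'.+1 then \sum_(x : V) Sum s' (fun l => F (x :: l)) else F [::].

(* "P holds for a positive proportion of the lists of length s", in a nested form
   that, unlike a plain count, composes under concatenation (Many_cat). *)
Fixpoint Many (b s : nat) P : bool :=
  if s is s'.+1 then #|V| <= b * #|[set x | Many b s' (fun l => P (x :: l))]|
  else P [::].

Lemma leq_Sum s F G :
  (forall l, size l = s -> F l <= G l) -> Sum s F <= Sum s G.
Proof.
elim: s F G => [|s IH] F G FG /=; first exact: FG.
by apply: leq_sum => x _; apply: IH => l sl; apply: FG; rewrite /= sl.
Qed.

Lemma eq_Sum s F G : (forall l, size l = s -> F l = G l) -> Sum s F = Sum s G.
Proof.
by move=> FG; apply/eqP; rewrite eqn_leq !leq_Sum // => l sl; rewrite FG.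
Qed.

Lemma Sum_add s F G : Sum s (fun l => F l + G l) = Sum s F + Sum s G.
Proof.
elim: s F G => [|s IH] F G //=.
by rewrite -big_split; apply: eq_bigr => x _; rewrite IH.
Qed.

Lemma Sum_mull s c F : Sum s (fun l => c * F l) = c * Sum s F.
Proof.
elim: s F => [|s IH] F //=.
by rewrite big_distrr; apply: eq_bigr => x _; rewrite IH.
Qed.

Lemma Sum_mulr s c F : Sum s (fun l => F l * c) = Sum s F * c.
Proof. by rewrite mulnC -Sum_mull; apply: eq_Sum => l _; rewrite mulnC. Qed.

Lemma Sum_const s c : Sum s (fun=> c) = #|V| ^ s * c.
Proof.
elim: s => [|s IH] /=; first by rewrite mul1n.
by rewrite IH sum_nat_const expnS mulnA.
Qed.

Lemma Sum_big (I : finType) s (F : I -> seq V -> nat) :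
  Sum s (fun l => \sum_i F i l) = \sum_i Sum s (F i).
Proof.
elim: s F => [|s IH] F //=.
by rewrite exchange_big; apply: eq_bigr => x _; rewrite IH.
Qed.

Lemma Sum_exchange s1 s2 (F : seq V -> seq V -> nat) :
  Sum s1 (fun l1 => Sum s2 (F l1)) = Sum s2 (fun l2 => Sum s1 (fun l1 => F l1 l2)).
Proof.
elim: s1 F => [|s1 IH] F //=.
rewrite Sum_big; apply: eq_bigr => x _; exact: IH.
Qed.

Lemma Sum_pos s F : 0 < Sum s F -> exists2 l, size l = s & 0 < F l.
Proof.
elim: s F => [|s IH] F /=; first by move=> F0; exists [::].
rewrite lt0n sum_nat_eq0 negb_forall => /existsP[x /=]; rewrite -lt0n => /IH[l sl Fl].
by exists (x :: l); rewrite //= sl.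
Qed.

Lemma Sum_ltP s F G : Sum s F < Sum s G -> exists2 l, size l = s & F l < G l.
Proof.
move=> lt; have [l sl] : exists2 l, size l = s & 0 < G l - F l.
  apply: Sum_pos; have: Sum s G <= Sum s F + Sum s (fun l => G l - F l).
    by rewrite -Sum_add; apply: leq_Sum => l _; lia.
  by lia.
by exists l => //; lia.
Qed.

Lemma Sum_tuple s F : Sum s F = \sum_(t : s.-tuple V) F t.
Proof.
elim: s F => [|s IH] F /=.
  rewrite (big_pred1 [tuple]) // => t; symmetry; apply/eqP; exact: tuple0.
under eq_bigr do rewrite IH.
rewrite pair_big /=.
rewrite [RHS](reindex (fun p : V * s.-tuple V => cons_tuple p.1 p.2)) //=.
exists (fun t : s.+1.-tuple V => (thead t, behead_tuple t)).
  by case=> x t _ /=; congr pair; apply: val_inj.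
by move=> t _; rewrite [in RHS](tuple_eta t).
Qed.

Lemma Sum_ffun s (F : seq V -> nat) :
  Sum s F = \sum_(x : {ffun 'I_s -> V}) F [seq x i | i <- enum 'I_s].
Proof.
rewrite Sum_tuple (reindex (fun x : {ffun 'I_s -> V} => [tuple x i | i < s])) //=.
exists (fun t => [ffun i => tnth t i]) => t _.
  by apply/ffunP => i; rewrite ffunE tnth_mktuple.
by apply: eq_from_tnth => i; rewrite tnth_mktuple ffunE.
Qed.

Lemma Many_impl b b' s P Q : b <= b' ->
  (forall l, size l = s -> P l -> Q l) -> Many b s P -> Many b' s Q.
Proof.
move=> bb; elim: s P Q => [|s IH] P Q PQ /=; first exact: PQ.
move=> /leq_trans; apply; apply: leq_mul => //; apply/subset_leq_card/subsetP => x.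
by rewrite !inE; apply: IH => l sl; apply: PQ; rewrite /= sl.
Qed.

Lemma Many_cat b s1 s2 P :
  Many b (s1 + s2) P = Many b s1 (fun l1 => Many b s2 (fun l2 => P (l1 ++ l2))).
Proof.
elim: s1 P => [|s1 IH] P //=; congr (_ <= _ * #|pred_of_set _|).
by apply/setP => x; rewrite !inE IH.
Qed.

Lemma Many_Sum b s P : Many b s P -> #|V| ^ s <= b ^ s * Sum s P.
Proof.
elim: s P => [|s IH] P /=; first by move=> ->.
set A := [set x | _] => nA; rewrite !expnS.
have -> : b * b ^ s * \sum_x Sum s (fun l => P (x :: l))
        = b * \sum_x b ^ s * Sum s (fun l => P (x :: l)).
  by rewrite -mulnA big_distrr.
apply: (@leq_trans (b * (#|A| * #|V| ^ s))).
  by rewrite mulnA leq_mul2r nA orbT.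
rewrite leq_mul2l; apply/orP; right.
rewrite -sum_nat_const [X in _ <= X](bigID (mem A)) /=.
apply: leq_trans (leq_addr _ _); apply: leq_sum => x; rewrite inE => /IH //.
Qed.

Lemma Sum_bool_le s P : Sum s P <= #|V| ^ s.
Proof.
apply: leq_trans (_ : Sum s (fun=> 1) <= _); last by rewrite Sum_const muln1.
by apply: leq_Sum => l _; case: (P l).
Qed.

(** Averaging over the first entry: entries whose fibre has proportion below 1/(2c) contribute at
    most half of the total, so at least |V|/(2c) entries remain. Each level doubles the constant. *)
Lemma Sum_Many c s P : #|V| ^ s <= c * Sum s P -> Many (2 ^ s * c) s P.
Proof.
elim: s c P => [|s IH] c P /=; first by case: (P _); rewrite ?muln0.
move=> H.
have [n0|n0] := posnP #|V|; first by rewrite n0.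
set g := fun x => Sum s (fun l => P (x :: l)).
set A := [set x | #|V| ^ s <= 2 * c * g x].
have nA : #|V| <= 2 * c * #|A|.
  have E : #|V| ^ s.+1 * 2 <= 2 * c * (#|A| * #|V| ^ s) + #|V| ^ s.+1.
    apply: (@leq_trans (2 * c * \sum_x g x)); first by rewrite mulnC -mulnA leq_mul2l.
    rewrite (bigID (mem A)) /= mulnDr; apply: leq_add.
      rewrite leq_mul2l; apply/orP; right; rewrite -sum_nat_const.
      by apply: leq_sum => x _; apply: Sum_bool_le.
    rewrite big_distrr /= expnS -sum_nat_const.
    apply: leq_trans (_ : \sum_(i | i \notin A) #|V| ^ s <= _).
      by apply: leq_sum => x; rewrite inE -ltnNge => /ltnW.
    by rewrite !sum_nat_const leq_mul2r max_card orbT.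
  have E2 : #|V| * #|V| ^ s <= (2 * c * #|A|) * #|V| ^ s.
    by move: E; rewrite expnS; lia.
  by move: E2; rewrite leq_mul2r expn_eq0 eqn0Ngt n0.
apply: leq_trans nA _; apply: leq_mul.
  by rewrite leq_mul2r expnS leq_pmulr ?orbT // expn_gt0.
apply/subset_leq_card/subsetP => x; rewrite !inE => /IH.
by rewrite mulnA -expnSr.
Qed.

(** [Many] depends on the order of its coordinates, so the swap goes through plain counts, where
    sums commute, and back by averaging; hence the larger constant. *)
Lemma Many_Fubini b s1 s2 (R : seq V -> seq V -> bool) :
  Many b s1 (fun l1 => Many b s2 (R l1)) ->
  Many ((2 * b) ^ (s1 + s2)) s2
    (fun l2 => Many ((2 * b) ^ (s1 + s2)) s1 (fun l1 => R l1 l2)).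
Proof.
move=> H.
have H1 : Many b (s1 + s2) (fun l => R (take s1 l) (drop s1 l)).
  rewrite Many_cat; apply: Many_impl H => // l1 s1l; apply: Many_impl => // l2 _.
  by rewrite -s1l take_size_cat ?drop_size_cat.
have catS t1 t2 F : Sum (t1 + t2) F = Sum t1 (fun l1 => Sum t2 (fun l2 => F (l1 ++ l2))).
  elim: t1 F => [|t1 IH] F //=; apply: eq_bigr => x _; exact: IH.
have {H1}/Many_Sum H2 := H1; move: H2; rewrite catS.
have -> : Sum s1 (fun l1 => Sum s2 (fun l2 => R (take s1 (l1 ++ l2)) (drop s1 (l1 ++ l2))))
  = Sum s2 (fun l2 => Sum s1 (fun l1 => (R l1 l2 : nat))).
  rewrite (Sum_exchange s2 s1); apply: eq_Sum => l1 sl1; apply: eq_Sum => l2 _.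
  by rewrite -sl1 take_size_cat ?drop_size_cat.
have -> : Sum s2 (fun l2 => Sum s1 (fun l1 => R l1 l2))
  = Sum (s2 + s1) (fun l => R (drop s2 l) (take s2 l)).
  rewrite catS; apply: eq_Sum => l2 sl2; apply: eq_Sum => l1 _.
  by rewrite -sl2 take_size_cat ?drop_size_cat.
rewrite addnC => /Sum_Many; rewrite -expnMn Many_cat.
apply: Many_impl => // l2 sl2; apply: Many_impl => // l1 _.
by rewrite -sl2 take_size_cat ?drop_size_cat.
Qed.

(** At each level only [U] and the entries already chosen are forbidden, and the size hypothesis
    makes this at most half of the |V|/b good entries. *)
Lemma Many_avoid b s P (U : {set V}) :
  2 * b * (#|U| + s) <= #|V| -> Many b s P ->
  Many (2 * b) s (fun l => [&& P l, uniq l & ~~ has (mem U) l]).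
Proof.
elim: s P U => [|s IH] P U hn /=; first by move=> ->.
set A := [set x | _] => nA.
have sub : A :\: U \subset [set x | Many (2 * b) s
     (fun l => [&& P (x :: l), (x \notin l) && uniq l & ~~ ((x \in U) || has (mem U) l)])].
  apply/subsetP => x; rewrite !inE => /andP[xU].
  move=> /(IH _ (x |: U)); rewrite cardsU1 xU add1n addSnnS => /(_ hn)/Many_impl; apply => //.
  move=> l _ /and3P[-> -> /hasPn H] /=.
  rewrite (negPf xU) andbT /=; apply/andP; split.
    by apply/negP => /H; rewrite /= !inE eqxx.
  by apply/hasPn => y /H; rewrite /= !inE negb_or => /andP[].
have /subset_leq_card := sub; have := cardsD A U; have := subset_leq_card (subsetIr A U).
move: nA hn; rewrite -/A; move: #|_ :&: _| => i; move: #|[set x | _]| => c.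
move=> nA hn h1 -> h2; move: (#|A|) (#|U|) (#|V|) nA hn h1 h2 => a u n; nia.
Qed.

(** The second list is chosen after the first and away from it and from [U], so the final
    implication may assume that all vertices are distinct and outside [U]. *)
Lemma Many_bind b1 b2 s1 s2 P1 (P2 : seq V -> seq V -> bool) (U : {set V}) Q :
  2 * (b1 + b2) * (#|U| + s1 + s2) <= #|V| ->
  Many b1 s1 P1 ->
  (forall l1, size l1 = s1 -> P1 l1 -> uniq l1 -> ~~ has (mem U) l1 -> Many b2 s2 (P2 l1)) ->
  (forall l1 l2, size l1 = s1 -> size l2 = s2 -> P1 l1 -> P2 l1 l2 -> uniq (l1 ++ l2) ->
     ~~ has (mem U) (l1 ++ l2) -> Q (l1 ++ l2)) ->
  Many (2 * (b1 + b2)) (s1 + s2) Q.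
Proof.
move=> hn M1 M2 PQ; rewrite Many_cat.
have hn1 : 2 * b1 * (#|U| + s1) <= #|V|.
  by apply: leq_trans hn; apply: leq_mul; lia.
apply: (Many_impl _ _ (Many_avoid hn1 M1)); first by lia.
move=> l1 sl1 /and3P[Pl1 ul1 hl1].
have hn2 : 2 * b2 * (#|U :|: [set x in l1]| + s2) <= #|V|.
  apply: leq_trans hn; apply: leq_mul; first by lia.
  have := cardsU U [set x in l1]; have -> : #|[set x in l1]| = s1.
    by rewrite cardsE; move/card_uniqP: ul1 => ->.
  by move: #|_ :|: _| => u ->; lia.
apply: (Many_impl _ _ (Many_avoid hn2 (M2 _ sl1 Pl1 ul1 hl1))); first by lia.
move=> l2 sl2 /and3P[Pl2 ul2 /hasPn hl2].
apply: PQ => //; last first.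
  rewrite has_cat (negPf hl1) /=; apply/hasPn => x /hl2 /=.
  by rewrite !inE negb_or => /andP[].
rewrite cat_uniq ul1 ul2 andbT /=; apply/hasPn => x /hl2 /=.
by rewrite !inE negb_or => /andP[].
Qed.

(** A complete partite pattern: [l] is cut into blocks of sizes [sz], and [P] holds on every
    transversal of the blocks. The continuation form peels off one block at a time, which suits an
    induction on the number of blocks. *)
Fixpoint Blow (sz : seq nat) P (l : seq V) : bool :=
  if sz is N :: sz' then
    Blow sz' (fun r => all (fun x => P (x :: r)) (take N l)) (drop N l)
  else P [::].

Lemma Blow_impl sz P Q l :
  (forall r, size r = size sz -> P r -> Q r) -> Blow sz P l -> Blow sz Q l.
Proof.
elim: sz P Q l => [|N sz IH] P Q l PQ /=; first exact: PQ.
apply: IH => r sr /allP h; apply/allP => x /h; apply: PQ; by rewrite /= sr.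
Qed.

Lemma BlowP sz P l t : Blow sz P l ->
  all2 (fun x (ch : seq V) => x \in ch) t (reshape sz l) -> P t.
Proof.
elim: sz P l t => [|N sz IH] P l [|x t] //= /IH h /andP[xl /h].
by move=> /allP; apply.
Qed.

End ManyTheory.

Lemma Many_all (V : finType) b N (P : V -> bool) :
  #|V| <= b * #|[set x | P x]| -> Many b N (fun X : seq V => all P X).
Proof.
move=> h; elim: N => [|N IH] //=; apply: leq_trans h _; rewrite leq_mul2l.
apply/orP; right; apply/subset_leq_card/subsetP => x; rewrite !inE => Px.
by apply: Many_impl IH => // l _ h; rewrite /= Px.
Qed.

(* Erdős's theorem on complete k-partite subgraphs. In the nested form no
   convexity is needed: x_1 is repeated N times given the other coordinates, and
   Many_Fubini then moves the repeated coordinate to the front. *)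
Lemma Many_Blow b sz : exists b', forall (V : finType) (P : seq V -> bool),
  Many b (size sz) P -> Many b' (sumn sz) (Blow sz P).
Proof.
elim: sz b => [|N sz IH] b /=; first by exists b.
set B := (2 * b) ^ (1 + size sz); set B' := (2 * B) ^ (size sz + N).
have [b' Hb'] := IH B'; exists (B' + b') => V P MP.
have /Many_Fubini : Many b 1 (fun l1 => Many b (size sz) (fun l2 => P (l1 ++ l2))) by [].
rewrite -/B => H1.
have : Many B (size sz) (fun r => Many B N (fun X => all (fun x => P (x :: r)) X)).
  by apply: Many_impl H1 => // r _ /= h; apply: Many_all.
move=> /Many_Fubini; rewrite -/B' => H2.
rewrite Many_cat; apply: Many_impl H2; first exact: leq_addr.
move=> X sX /Hb'; apply: Many_impl; first exact: leq_addl.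
move=> l _ /=; rewrite -sX drop_size_cat //; apply: Blow_impl => r _.
by rewrite take_size_cat.
Qed.

Lemma card_set_in_le (V : finType) (l : seq V) : #|[set x in l]| <= size l.
Proof. by rewrite cardsE card_size. Qed.

(** The common pattern of [exchange_trans] and [exchange_cancel]: an intermediate list [w], then two
    lists whose conditions both depend on [w] but not on each other. *)
Lemma Many_bind3 (V : finType) b0 b1 b2 t s1 s2 (P : seq V -> bool)
    (P1 P2 : seq V -> seq V -> bool) (U : {set V}) (Q : seq V -> bool) :
  4 * (b0 + b1 + b2) * (#|U| + t + s1 + s2) <= #|V| ->
  Many b0 t P ->
  (forall w, size w = t -> P w -> uniq w -> ~~ has (mem U) w ->
     Many b1 s1 (P1 w) /\ Many b2 s2 (P2 w)) ->
  (forall w S1 S2, size w = t -> P w -> P1 w S1 -> P2 w S2 -> uniq (w ++ S1 ++ S2) ->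
     ~~ has (mem U) (w ++ S1 ++ S2) -> Q (w ++ S1 ++ S2)) ->
  Many (4 * (b0 + b1 + b2)) (t + s1 + s2) Q.
Proof.
move=> hn M0 M12 PQ; rewrite -(addnA t).
apply: (@Many_impl _ (2 * (b0 + 2 * (b1 + b2))) _ _ Q Q); [lia | by [] |].
(* The existentials over tuples remember how the second list splits into [S1] and [S2]. *)
refine (@Many_bind _ b0 (2 * (b1 + b2)) t (s1 + s2) P
   (fun w S => [exists S1 : s1.-tuple V, exists S2 : s2.-tuple V,
      [&& S == S1 ++ S2 :> seq V, P1 w S1 & P2 w S2]]) U _ _ _ _ _) => //.
- by apply: leq_trans hn; apply: leq_mul; lia.
- move=> w sw Pw uw hw; have [M1 M2] := M12 _ sw Pw uw hw.
  apply: (@Many_bind _ _ _ _ _ _ (fun _ => P2 w) set0 _ _ M1) => //.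
    by rewrite cards0; apply: leq_trans hn; apply: leq_mul; lia.
  move=> l1 l2 /eqP sl1 /eqP sl2 h1 h2 _ _; apply/existsP; exists (Tuple sl1).
  by apply/existsP; exists (Tuple sl2); rewrite eqxx h1 h2.
- move=> w S sw sS Pw /existsP[S1 /existsP[S2 /and3P[/eqP -> p1 p2]]] un hU.
  exact: PQ.
Qed.

(** * Tileable lists and calculus of exchanges *)

Section Tile.
Variables (VF : finType) (EF : {set {set VF}}) (V : finType) (E : {set {set V}}).

Definition spans_copy (B : {set V}) :=
  [exists f : {ffun VF -> V}, [&& injectiveb f, f @: VF == B &
     [forall e in EF, (f @: (e : {set VF})) \in E]]].

Definition tileable (l : seq V) :=
  uniq l && [exists Q : {set {set V}}, partition Q [set x in l] && [forall B in Q, spans_copy B]].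

Definition exchange b s (u v : seq V) := Many b s (fun S => tileable (S ++ u) && tileable (S ++ v)).

Lemma tileable_nil : tileable [::].
Proof.
apply/andP; split => //; apply/existsP; exists set0; rewrite /partition.
rewrite /cover big_set0 /trivIset /cover !big_set0 cards0 eqxx !inE /=.
apply/andP; split; last by apply/forallP => B; rewrite inE.
by rewrite andbT; apply/eqP/setP => x; rewrite !inE.
Qed.

Lemma tileable_perm l l' : perm_eq l l' -> tileable l = tileable l'.
Proof.
move=> p; rewrite /tileable (perm_uniq p); suff -> : [set x in l] = [set x in l'] by [].
by apply/setP => x; rewrite !inE (perm_mem p).
Qed.

Lemma tileable_cat l l' : tileable l -> tileable l' -> uniq (l ++ l') -> tileable (l ++ l').
Proof.
move=> /andP[_ /existsP[Q /andP[/and3P[/eqP cQ tQ nQ] /forall_inP FQ]]].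
move=> /andP[_ /existsP[Q' /andP[/and3P[/eqP cQ' tQ' nQ'] /forall_inP FQ']]] un.
rewrite /tileable un /=; apply/existsP; exists (Q :|: Q').
apply/andP; split; last first.
  by apply/forall_inP => B; rewrite inE => /orP[/FQ|/FQ'].
apply/and3P; split.
- rewrite /cover bigcup_setU -!/(cover _) cQ cQ'; apply/eqP/setP => x.
  by rewrite !inE mem_cat.
- apply: trivIsetU => //; rewrite cQ cQ' -setI_eq0; apply/eqP/setP => x.
  rewrite !inE; apply/negP => /andP[xl xl']; move: un; rewrite cat_uniq => /and3P[_ /hasPn + _].
  by move=> /(_ _ xl'); rewrite /= xl.
- by rewrite inE negb_or nQ nQ'.
Qed.

Lemma spans_copy_card B : spans_copy B -> #|B| = #|VF|.
Proof.
case/existsP => f /and3P[/injectiveP fi /eqP <- _].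
by rewrite card_imset.
Qed.

Lemma tileable_size l : tileable l -> #|VF| %| size l.
Proof.
case/andP=> /card_uniqP ul /existsP[Q /andP[/card_partition + /forall_inP FQ]].
rewrite cardsE ul => ->; apply: dvdn_sum => B /FQ /spans_copy_card ->; exact: dvdnn.
Qed.

Lemma tileable_copy l : 0 < #|VF| -> uniq l -> spans_copy [set x in l] -> tileable l.
Proof.
move=> m0 ul Fl; rewrite /tileable ul; apply/existsP; exists [set [set x in l]].
apply/andP; split; last by apply/forall_inP => B; rewrite inE => /eqP ->.
apply/and3P; split; first by rewrite /cover big_set1.
  by apply/trivIsetP => A B; rewrite !inE => /eqP-> /eqP ->; rewrite eqxx.
by rewrite inE; apply: contraTneq m0 => h; rewrite -(spans_copy_card Fl) -h cards0.
Qed.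

Lemma uniq_cat_avoid (U : {set V}) (l u : seq V) :
  {subset u <= U} -> ~~ has (mem U) l -> uniq l -> uniq u -> uniq (l ++ u).
Proof.
move=> uU /hasPn h ul uu; rewrite cat_uniq ul uu andbT /=.
by apply/hasPn => x xu; apply/negP => /h /=; rewrite uU.
Qed.

Lemma tileable_perm2 (l u l1 u1 l2 u2 : seq V) :
  tileable (l1 ++ u1) -> tileable (l2 ++ u2) -> uniq (l ++ u) ->
  perm_eq (l ++ u) ((l1 ++ u1) ++ (l2 ++ u2)) -> tileable (l ++ u).
Proof. by move=> t1 t2 un p; rewrite (tileable_perm p); apply: tileable_cat => //; rewrite -(perm_uniq p). Qed.

Lemma perm4 (a b c d : seq V) : perm_eq ((a ++ b) ++ (c ++ d)) ((a ++ c) ++ (b ++ d)).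
Proof. by rewrite -!catA perm_cat2l perm_catCA. Qed.

Lemma exchange_cat b1 s1 b2 s2 u1 v1 u2 v2 :
  2 * (b1 + b2) * (size (u1 ++ v1 ++ u2 ++ v2) + s1 + s2) <= #|V| ->
  uniq (u1 ++ u2) -> uniq (v1 ++ v2) ->
  exchange b1 s1 u1 v1 -> exchange b2 s2 u2 v2 ->
  exchange (2 * (b1 + b2)) (s1 + s2) (u1 ++ u2) (v1 ++ v2).
Proof.
move=> hn uu uv h1 h2; pose U := [set x in u1 ++ v1 ++ u2 ++ v2].
have hU : #|U| <= _ := card_set_in_le _.
apply: (@Many_bind _ b1 b2 s1 s2 _ (fun _ S => tileable (S ++ u2) && tileable (S ++ v2)) U _ _ h1) => //.
  by apply: leq_trans hn; apply: leq_mul => //; rewrite !leq_add2r.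
move=> S1 S2 _ _ /andP[a1 a2] /andP[c1 c2] un hav.
have hs l : {subset l <= u1 ++ v1 ++ u2 ++ v2} -> uniq l -> uniq ((S1 ++ S2) ++ l).
  by move=> lU ul; apply: (uniq_cat_avoid (U := U)) => // x /lU; rewrite inE.
apply/andP; split; apply: (tileable_perm2 (l1 := S1) (l2 := S2)); try exact: perm4; eauto.
  apply: hs => // x; rewrite !mem_cat => /orP[->|->]; rewrite ?orbT //.
apply: hs => // x; rewrite !mem_cat => /orP[->|->]; rewrite ?orbT //.
Qed.

(** The witness is [w ++ S1 ++ S2]: with [u] it splits as (S1, u) and (S2, w), with [v] as (S1, w)
    and (S2, v). *)
Lemma exchange_trans b0 b1 b2 t s1 s2 P u v :
  4 * (b0 + b1 + b2) * (size (u ++ v) + t + s1 + s2) <= #|V| ->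
  uniq u -> uniq v -> Many b0 t P ->
  (forall w, size w = t -> P w -> uniq (w ++ u) -> uniq (w ++ v) ->
     exchange b1 s1 u w /\ exchange b2 s2 w v) ->
  exchange (4 * (b0 + b1 + b2)) (t + s1 + s2) u v.
Proof.
move=> hn uu uv M0 h; pose U := [set x in u ++ v].
have hU : #|U| <= _ := card_set_in_le _.
have hs l z : ~~ has (mem U) l -> uniq l -> {subset z <= u ++ v} -> uniq z -> uniq (l ++ z).
  by move=> h1 h2 zU uz; apply: (uniq_cat_avoid (U := U)) => // x /zU; rewrite inE.
have su : {subset u <= u ++ v} by move=> x; rewrite mem_cat => ->.
have sv : {subset v <= u ++ v} by move=> x; rewrite mem_cat => ->; rewrite orbT.
apply: (@Many_bind3 _ b0 b1 b2 t s1 s2 P (fun w S => tileable (S ++ u) && tileable (S ++ w))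
   (fun w S => tileable (S ++ w) && tileable (S ++ v)) U) => //.
- by apply: leq_trans hn; apply: leq_mul => //; rewrite !leq_add2r.
- by move=> w sw Pw uw hw; apply: h => //; apply: hs.
- move=> w S1 S2 sw Pw /andP[a1 a2] /andP[c1 c2] un hav.
  apply/andP; split.
    apply: (tileable_perm2 a1 c1); first exact: hs.
    by apply/seq.permP => p /=; rewrite !count_cat; clear; lia.
  apply: (tileable_perm2 a2 c2); first exact: hs.
  by apply/seq.permP => p /=; rewrite !count_cat; clear; lia.
Qed.

(** Let w1, w2 be the parts of [w] before and after position [d]. With [u] the witness
    [w ++ S1 ++ S2] splits as (S1, u, w1) and (S2, w2), with [u'] as (S1, u', w2) and (S2, w1). This
    subtraction is the source of the closure under differences. *)
Lemma exchange_cancel b0 b1 b2 t s1 s2 d P u u' :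
  4 * (b0 + b1 + b2) * (size (u ++ u') + t + s1 + s2) <= #|V| ->
  uniq (u ++ u') -> Many b0 t P ->
  (forall w, size w = t -> P w -> uniq (w ++ u ++ u') ->
     exchange b1 s1 (u ++ take d w) (u' ++ drop d w) /\ exchange b2 s2 (take d w) (drop d w)) ->
  exchange (4 * (b0 + b1 + b2)) (t + s1 + s2) u u'.
Proof.
move=> hn uu M0 h; pose U := [set x in u ++ u'].
have hU : #|U| <= _ := card_set_in_le _.
have hs l z : ~~ has (mem U) l -> uniq l -> {subset z <= u ++ u'} -> uniq z -> uniq (l ++ z).
  by move=> h1 h2 zU uz; apply: (uniq_cat_avoid (U := U)) => // x /zU; rewrite inE.
have su : {subset u <= u ++ u'} by move=> x; rewrite mem_cat => ->.
have sv : {subset u' <= u ++ u'} by move=> x; rewrite mem_cat => ->; rewrite orbT.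
have [uu1 _ uu2] : [/\ uniq u, ~~ has (mem u) u' & uniq u'].
  by apply/and3P; rewrite -cat_uniq.
apply: (@Many_bind3 _ b0 b1 b2 t s1 s2 P
   (fun w S => tileable (S ++ u ++ take d w) && tileable (S ++ u' ++ drop d w))
   (fun w S => tileable (S ++ take d w) && tileable (S ++ drop d w)) U) => //.
- by apply: leq_trans hn; apply: leq_mul => //; rewrite !leq_add2r.
- by move=> w sw Pw uw hw; apply: h => //; apply: hs.
move=> w S1 S2 sw Pw /andP[a1 a2] /andP[c1 c2] un hav.
have cw p : count p w = count p (take d w) + count p (drop d w).
  by rewrite -count_cat cat_take_drop.
apply/andP; split.
  apply: (tileable_perm2 a1 c2); first exact: hs.
  by apply/seq.permP => p /=; rewrite !count_cat cw; clear; lia.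
apply: (tileable_perm2 a2 c1); first exact: hs.
by apply/seq.permP => p /=; rewrite !count_cat cw; clear; lia.
Qed.

End Tile.

Lemma exchange_lift (VF : finType) (EF : {set {set VF}}) b s d : exists b' n0,
  forall (V : finType) (E : {set {set V}}) u v, n0 <= #|V| -> size u = d -> size v = d ->
  uniq (u ++ v) -> (forall x y, x \in u -> y \in v -> exchange EF E b s [:: x] [:: y]) ->
  exchange EF E b' (d * s) u v.
Proof.
elim: d => [|d [b' [n0 IH]]].
  by exists 1, 0 => V E [|//] [|//] _ _ _ _ _; rewrite /exchange /= tileable_nil.
exists (2 * (b + b')), (n0 + 2 * (b + b') * (d.*2.+2 + s + d * s)).
move=> V E [//|x u] [//|y v] hn [su] [sv] /= /andP[xuv un] h.
have [un1 [un2 un3]] : uniq (u ++ v) /\ uniq (x :: u) /\ uniq (y :: v).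
  move: xuv un; rewrite mem_cat negb_or !cat_uniq /= => /andP[-> _].
  by case/and4P=> -> /norP[_ ->] -> ->.
apply: (@exchange_cat _ _ _ _ b s b' (d * s) [:: x] [:: y] u v) => //.
- apply: leq_trans hn; apply: leq_trans (leq_addl _ _); apply: leq_mul => //.
  rewrite /= size_cat su sv; lia.
- by apply: h; rewrite mem_head.
apply: IH => //; first by lia.
by move=> x' y' xu yv; apply: h; rewrite inE ?xu ?yv orbT.
Qed.

(** * Copies of F from blown-up edges *)

Definition edge (V : finType) (E : {set {set V}}) (l : seq V) := [set x in l] \in E.

Lemma eq_edge (V : finType) (E : {set {set V}}) l l' : l =i l' -> edge E l = edge E l'.
Proof. by move=> h; congr (_ \in E); apply/setP => x; rewrite !inE h. Qed.

Lemma edge_uniq k (V : finType) (E : {set {set V}}) l :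
  uniform k E -> size l = k -> edge E l -> uniq l.
Proof.
by move=> hU sl /hU h; apply/card_uniqP; rewrite sl -h cardsE.
Qed.

Section Copy.
Variables (k : nat) (VF : finType) (EF : {set {set VF}}) (c : {ffun VF -> 'I_k}).

Definition vclass i := [set v | c v == i].
Definition class_seq := flatten [seq enum (vclass i) | i <- enum 'I_k].
Definition class_sizes := [seq #|vclass i| | i <- enum 'I_k].

Lemma size_class_sizes : size class_sizes = k. Proof. by rewrite size_map size_enum_ord. Qed.

Lemma shape_class_seq : shape [seq enum (vclass i) | i <- enum 'I_k] = class_sizes.
Proof. by rewrite /shape -map_comp; apply: eq_map => i /=; rewrite -cardE. Qed.

Lemma mem_class_seq v : v \in class_seq.
Proof.
apply/flattenP; exists (enum (vclass (c v))); last by rewrite mem_enum inE.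
by apply: map_f; rewrite mem_enum.
Qed.

Lemma sumn_class_sizes : sumn class_sizes = #|VF|.
Proof.
rewrite sumnE big_map big_enum /= -sum1_card (partition_big c xpredT) //=.
by apply: eq_bigr => i _; rewrite sum1_card; apply: eq_card => v; rewrite !inE.
Qed.

Lemma size_class_seq : size class_seq = #|VF|.
Proof. by rewrite size_flatten shape_class_seq sumn_class_sizes. Qed.

Lemma uniq_class_seq : uniq class_seq.
Proof. by apply/card_uniqP; rewrite size_class_seq; apply: eq_card => v; rewrite mem_class_seq. Qed.

Hypothesis hc : realisation EF c.

Lemma class_sizes_pos : EF != set0 -> all (leq 1) class_sizes.
Proof.
case/set0Pn => e eE; apply/allP => _ /mapP[i _ ->].
have /forall_inP/(_ e eE)/forallP/(_ i)/cards1P[v hv] := hc.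
have : v \in [set v] by rewrite inE.
by rewrite -hv !inE => /andP[_ cv]; apply/card_gt0P; exists v; rewrite inE.
Qed.

(** The vertices of F, listed class by class, are matched with [l] position by position. An edge of
    F has one vertex in each class, so its image is a transversal of the blocks. *)
Lemma Blow_spans_copy (V : finType) (E : {set {set V}}) l : 0 < #|VF| -> uniq l ->
  size l = #|VF| -> Blow class_sizes (edge E) l -> spans_copy EF E [set x in l].
Proof.
move=> m0 ul sl B.
have [x0 _] : exists x, x \in l.
  by case: l sl {ul B} => [|x l] sl; [rewrite -sl in m0 | exists x; rewrite mem_head].
have [v0 _] : exists v, v \in VF by apply/card_gt0P.
pose f := [ffun v => nth x0 l (index v class_seq)].
have map_class_seq : map f class_seq = l.
  apply: (@eq_from_nth _ x0); first by rewrite size_map size_class_seq.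
  move=> i; rewrite size_map => hi; rewrite (nth_map v0) // ffunE index_uniq ?uniq_class_seq //.
have finj : injective f.
  move=> v v'; rewrite !ffunE => /eqP; rewrite nth_uniq ?sl -?size_class_seq ?index_mem ?mem_class_seq //.
  by move=> /eqP h; rewrite -(nth_index v0 (mem_class_seq v)) h nth_index ?mem_class_seq.
apply/existsP; exists f; apply/and3P; split; first exact/injectiveP.
  apply/eqP/setP => x; rewrite -map_class_seq inE; apply/imsetP/mapP => [] [v _ ->]; exists v => //.
  exact: mem_class_seq.
apply/forall_inP => e eE.
have [g hg] : exists g : 'I_k -> VF, forall i, [set x in e | c x == i] = [set g i].
  apply: (@fin_all_exists _ (fun=> VF) (fun i v => [set x in e | c x == i] = [set v])) => i.
  by have /forall_inP/(_ e eE)/forallP/(_ i)/cards1P := hc.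
have {B} := BlowP (t := [seq f (g i) | i <- enum 'I_k]) B.
rewrite -map_class_seq -map_reshape -shape_class_seq flattenK => /(_ _); rewrite /edge.
have -> : [set x in [seq f (g i) | i <- enum 'I_k]] = f @: e.
  apply/setP => x; rewrite inE; apply/mapP/imsetP => [[i _ ->]|[v ve ->]].
    exists (g i) => //; have : g i \in [set g i] by rewrite inE.
    by rewrite -hg inE => /andP[].
  exists (c v); first by rewrite mem_enum.
  have : v \in [set x in e | c x == c v] by rewrite inE ve eqxx.
  by rewrite hg inE => /eqP <-.
apply; have hm i : f (g i) \in map f (enum (vclass i)).
  apply: map_f; rewrite mem_enum; have : g i \in [set g i] by rewrite inE.
  by rewrite -hg !inE => /andP[].
by elim: (enum 'I_k) => [//|i r IH] /=; rewrite hm IH.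
Qed.

End Copy.

(** * Vertices with a dense common link, and dependent random choice *)

Definition codegE k b (V : finType) (E : {set {set V}}) :=
  forall S : seq V, uniq S -> size S = k.-1 -> #|V| <= b * #|[set z | edge E (z :: S)]|.

Definition near k b (V : finType) (E : {set {set V}}) x y :=
  Many b k.-1 (fun S => edge E (x :: S) && edge E (y :: S)).

(** For [S] in the common link of [x] and [y], the codegree condition supplies many [z] such that
    [S] forms an edge with each of [x], [y], [z]. Blowing up these patterns gives copies of F in
    which one vertex [z] may be replaced by [x] or by [y]. *)
Lemma near_exchange k (VF : finType) (EF : {set {set VF}}) (c : {ffun VF -> 'I_k}) b ba :
  realisation EF c -> EF != set0 -> 0 < k -> exists s b' n0,
  forall (V : finType) (E : {set {set V}}) x y, uniform k E -> codegE k ba E ->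
    n0 <= #|V| -> x != y -> near k b E x y -> exchange EF E b' s [:: x] [:: y].
Proof.
move=> hc EF0 k0.
have m0 : 0 < #|VF|.
  have := class_sizes_pos hc EF0; rewrite -(sumn_class_sizes c); have := size_class_sizes c.
  case: (class_sizes c) => [|a r] /=; first by move=> k_0; rewrite -k_0 in k0.
  by move=> _ /andP[a0 _]; rewrite addn_gt0 a0.
set B := (2 * (b + ba)) ^ (k.-1 + 1).
have [b' hb'] := Many_Blow B (class_sizes c).
exists #|VF|.-1, (2 * b'), (2 * b' * (2 + #|VF|)).+1 => V E x y hU hcd hn xy nxy.
pose P l := [&& edge E l, edge E (x :: behead l) & edge E (y :: behead l)].
have : Many B k P.
  rewrite -(prednK k0) -addn1 addnC Many_cat.
  have /Many_Fubini : Many (b + ba) k.-1 (fun S => Many (b + ba) 1 (fun z => P (z ++ S))).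
    apply: Many_impl nxy; first exact: leq_addr.
    move=> S sS /andP[xS yS].
    have uS : uniq S.
      by have := edge_uniq hU _ xS; rewrite /= sS prednK // => /(_ erefl)/andP[].
    rewrite /=; apply: leq_trans (hcd S uS sS) _; apply: leq_mul; first exact: leq_addl.
    by apply/subset_leq_card/subsetP => z; rewrite !inE /P /= xS yS => ->.
  exact.
rewrite -(size_class_sizes c) => /hb'; rewrite sumn_class_sizes => M.
have {M} := Many_avoid (U := [set x; y]) _ M.
rewrite cards2 xy => /(_ (ltnW hn)).
case Em : #|VF| m0 => [//|m'] _ /= hM.
(* One good first vertex [z] is fixed and then discarded; only the other [m'] vertices have to vary,
   and [x] or [y] takes its place. *)
have : 0 < #|[set z | Many (2 * b') m' (fun l => [&& Blow (class_sizes c) P (z :: l),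
    (z \notin l) && uniq l & ~~ ((z \in [set x; y]) || has (mem [set x; y]) l)])]|.
  rewrite lt0n; apply/eqP => h0; move: hM; rewrite h0 muln0 leqn0 => /eqP h; by rewrite h in hn.
case/card_gt0P => z; rewrite inE; apply: Many_impl => // l sl.
case/and3P => Bl /andP[_ ul] /norP[_ /hasPn hl].
suff H w : w \in [set x; y] -> (forall r, P (z :: r) -> edge E (w :: r)) -> tileable EF E (l ++ [:: w]).
  by apply/andP; split; apply: H; rewrite ?inE ?eqxx ?orbT // => r /and3P[].
move=> hw hP; rewrite cats1 (tileable_perm EF E (l' := w :: l)) ?perm_rcons //.
have uwl : uniq (w :: l) by rewrite /= ul andbT; apply/negP => /hl /=; rewrite hw.
apply: tileable_copy => //; first by rewrite Em.
apply: (Blow_spans_copy hc) => //=; rewrite ?Em ?sl //.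
(* The first class is nonempty, so [z] heads the first block, and replacing it changes only the
   transversals that start with [z]. *)
have := class_sizes_pos hc EF0; case: (class_sizes c) (size_class_sizes c) Bl => [|[|a] r] //=.
  by move=> sz; move: k0; rewrite -sz.
rewrite /= => _ Bl _; apply: Blow_impl Bl => t _ /andP[Pz Pt].
rewrite hP //=; apply/allP => v /(allP Pt) /and3P[] //.
Qed.

(** The codegree condition speaks of distinct vertices only: k-2 of them are chosen distinct and
    different from [w], and the last one then comes from the codegree. *)
Lemma link_Many k ba (V : finType) (E : {set {set V}}) w : 1 < k ->
  codegE k ba E -> 2 * k <= #|V| -> Many (2 + ba) k.-1 (fun S => edge E (w :: S)).
Proof.
case: k => [|[|k]] //= _ hcd hn; change (Many (2 + ba) k.+1 (fun S => edge E (w :: S))).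
have MT : Many 1 k (fun _ : seq V => true).
  elim: k {hcd hn} => [//|k IH] /=; rewrite mul1n -cardsT.
  by apply/subset_leq_card/subsetP => x _; rewrite inE; apply: Many_impl IH.
have h : 2 * 1 * (#|[set w]| + k) <= #|V|. rewrite cards1. move: hn; move: #|V| => n hn; lia.
rewrite -(addn1 k) Many_cat; apply: Many_impl (Many_avoid h MT); first by lia.
move=> T sT /and3P[_ uT /hasPn hT].
have /hcd : uniq (w :: T).
  by rewrite /= uT andbT; apply/negP => /hT; rewrite /= inE eqxx.
rewrite /= sT => /(_ erefl) hz; apply: leq_trans hz _; apply: leq_mul; first by lia.
apply/subset_leq_card/subsetP => z; rewrite !inE => hz.
suff <- : edge E (z :: w :: T) = edge E (w :: T ++ [:: z]) by [].
by apply: eq_edge => y; rewrite !(inE, mem_cat) orbC orbA.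
Qed.

(* Dependent random choice: for a typical S in the link of w, almost all pairs
   in N(S) have a dense common link, since a pair with a sparse one lies in few N(S). *)
Lemma near_set k ba : 1 < k -> exists b c1,
  forall (V : finType) (E : {set {set V}}), uniform k E -> codegE k ba E ->
  2 * k <= #|V| -> forall w, exists Z : {set V}, [/\ #|V| <= c1 * #|Z|,
    (forall z, z \in Z -> near k b E w z) &
    (forall x y, x \in Z -> y \in Z ->
       #|V| <= c1 * #|[set z | near k b E x z && near k b E y z]|)].
Proof.
(* The link of [w] has proportion at least 1/B, and N(S) at least 1/ba. The factor 32 makes each of
   the exceptional sets [A1], [A2] below at most a quarter of N(S). *)
move=> k1; set j := k.-1; set B := (2 + ba) ^ j; set C := 32 * B * ba ^ 2.
exists (2 ^ j * C), (2 * ba) => V E hU hcd hn w.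
set n := #|V|; set nr := near k (2 ^ j * C) E.
have L : n ^ j <= B * Sum j (fun S => edge E (w :: S)) by exact: Many_Sum (link_Many w k1 hcd hn).
(* A common link of proportion above 1/C would make the pair near, by [Sum_Many]. *)
have far x z : C * Sum j (fun S => [&& edge E (x :: S), edge E (z :: S) & ~~ nr x z]) <= n ^ j.
  have [nxz|nxz] := boolP (nr x z).
    rewrite (eq_Sum (G := fun=> 0)) ?Sum_const ?muln0 // => l _.
    by rewrite /= !andbF.
  rewrite leqNgt; apply: contra nxz => lt; apply: Sum_Many.
  apply: ltnW; apply: leq_trans lt _; rewrite leq_mul2l; apply/orP; right.
  by apply: leq_Sum => l _; case: edge => //; case: edge => //; case: (~~ _).
pose bad1 S := \sum_z (edge E (z :: S) && ~~ nr w z).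
pose bad2 S := \sum_z \sum_z' [&& edge E (z :: S), edge E (z' :: S) & ~~ nr z z'].
(* The factor [edge E (w :: S)] on both sides restricts the average to the link of [w], and the
   strict inequality forces [S] into it; [.+1] supplies the strictness. *)
have [S sS] : exists2 S, size S = j & edge E (w :: S) * (C * (n * bad1 S + bad2 S))
     < edge E (w :: S) * (2 * n ^ 2 * B).+1.
  apply: Sum_ltP; rewrite Sum_mulr.
  have n0 : 0 < n by lia.
  have L0 : 0 < Sum j (fun S => edge E (w :: S)).
    by rewrite lt0n; apply: contraTneq L => ->; rewrite muln0 -ltnNge expn_gt0 n0.
  apply: (@leq_ltn_trans (2 * n ^ 2 * n ^ j)); last first.
    apply: (@leq_ltn_trans (2 * n ^ 2 * (B * Sum j (fun S => edge E (w :: S))))).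
      by rewrite leq_mul2l L orbT.
    by move: L0; move: (Sum _ _) => x; nia.
  apply: (@leq_trans (n * \sum_z C * Sum j (fun S => [&& edge E (w :: S), edge E (z :: S) & ~~ nr w z])
     + \sum_z \sum_z' C * Sum j (fun S => [&& edge E (z :: S), edge E (z' :: S) & ~~ nr z z']))).
    under eq_bigr do rewrite -Sum_mull.
    under [X in _ <= _ + X]eq_bigr do under eq_bigr do rewrite -Sum_mull.
    rewrite -Sum_big -Sum_mull.
    under [X in _ <= _ + X]eq_bigr do rewrite -Sum_big.
    rewrite -Sum_big -Sum_add; apply: leq_Sum => l _.
    case: (edge E (w :: l)) => //=; rewrite mul1n mulnDr; apply: leq_add.
      by rewrite mulnCA -big_distrr.
    rewrite /bad2 big_distrr; apply: leq_sum => z _ /=; by rewrite big_distrr.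
  have -> : 2 * n ^ 2 * n ^ j = n * (n * n ^ j) + n * (n * n ^ j).
    by rewrite -mulnA mul2n -addnn mulnA.
  apply: leq_add; first rewrite leq_mul2l; first (apply/orP; right).
    by rewrite -sum_nat_const; apply: leq_sum => z _; apply: far.
  rewrite -[X in _ <= X]sum_nat_const; apply: leq_sum => z _.
  by rewrite -sum_nat_const; apply: leq_sum => z' _; apply: far.
case wS: (edge E (w :: S)) => //; rewrite !mul1n ltnS => bd.
have uS : uniq S.
  have := edge_uniq hU _ wS; rewrite /= sS /j prednK ?(ltnW k1) //.
  by move=> /(_ erefl)/andP[].
pose Z := [set z | edge E (z :: S)].
have nZ : n <= ba * #|Z| by apply: hcd.
pose bz z := #|[set z' in Z | ~~ nr z z']|.
pose A1 := [set z in Z | ~~ nr w z].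
pose A2 := [set z in Z | #|Z| < 4 * bz z].
have b1 : bad1 S = #|A1|.
  by rewrite -sum1_card [RHS]big_mkcond; apply: eq_bigr => z _; rewrite !inE; case: (_ && _).
have b2 : #|A2| * #|Z| <= 4 * bad2 S.
  rewrite -sum_nat_const /bad2 big_distrr [X in X <= _]big_mkcond /=.
  apply: leq_sum => z _; rewrite !inE; case: (edge E (z :: S)) => //=.
  case: ifP => // /ltnW h; apply: leq_trans h _; rewrite leq_mul2l /=.
  rewrite /bz -sum1_card big_mkcond; apply: leq_sum => z' _; rewrite !inE.
  by case: (_ && _).
have c1 : 4 * #|A1| <= #|Z|.
  move: bd nZ; rewrite b1 /C; move: (bad2 S) (#|A1|) (#|Z|) => q a z.
  have : 0 < n by lia.
  have : 0 < B by rewrite expn_gt0.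
  move: (B) (n) => B1 n1 B0 n0 bd nZ.
  have h1 : 32 * ba ^ 2 * (n1 * a) <= 2 * n1 ^ 2.
    have: B1 * (32 * ba ^ 2 * (n1 * a)) <= B1 * (2 * n1 ^ 2) by nia.
    by rewrite leq_mul2l; lia.
  have h2 : 16 * ba ^ 2 * a <= n1.
    have: n1 * (16 * ba ^ 2 * a) <= n1 * n1 by nia.
    by rewrite leq_mul2l; lia.
  have h3 : 0 < ba by case: (ba) nZ => //; lia.
  have h4 : ba * (16 * ba * a) <= ba * z by nia.
  by move: h4; rewrite leq_mul2l; nia.
have c2 : 4 * #|A2| <= #|Z|.
  move: bd nZ b2; rewrite b1 /C; move: (bad2 S) (#|A1|) (#|Z|) (#|A2|) => q a z a2.
  have : 0 < n by lia.
  have : 0 < B by rewrite expn_gt0.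
  move: (B) (n) => B1 n1 B0 n0 bd nZ b2.
  have h1 : 32 * ba ^ 2 * q <= 2 * n1 ^ 2.
    have: B1 * (32 * ba ^ 2 * q) <= B1 * (2 * n1 ^ 2) by nia.
    by rewrite leq_mul2l; lia.
  have h3 : 0 < ba by case: (ba) nZ => //; lia.
  have h2 : 16 * ba ^ 2 * q <= ba ^ 2 * z ^ 2 by nia.
  have h4 : 16 * q <= z ^ 2.
    have: ba ^ 2 * (16 * q) <= ba ^ 2 * z ^ 2 by nia.
    by rewrite leq_mul2l expn_eq0; lia.
  have z0 : 0 < z by nia.
  have: (4 * a2) * z <= z * z by nia.
  by rewrite leq_mul2r; lia.
exists (Z :\: (A1 :|: A2)); split.
- apply: leq_trans nZ _; rewrite -mulnA mulnCA leq_mul2l; apply/orP; right.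
  have := cardsD Z (A1 :|: A2); have := subset_leq_card (subsetIr Z (A1 :|: A2)).
  have := cardsU A1 A2; rewrite -/Z; move: #|_ :&: _| => i1; move: #|_ :&: _| => i2.
  by move: (#|_ :|: _|) (#|_ :\: _|) => x y; lia.
- move=> z; rewrite !inE; by case: (edge E (z :: S)) => //=; case: (nr w z).
(* Outside [A2] a vertex is near to all but at most a quarter of N(S), so at least half of N(S) is
   near to both [x] and [y]. *)
move=> x y; rewrite !inE => /andP[/norP[_ hx] xZ] /andP[/norP[_ hy] yZ].
move: hx hy; rewrite xZ yZ /= -!leqNgt => hx hy.
pose D := [set z' in Z | ~~ nr x z'] :|: [set z' in Z | ~~ nr y z'].
apply: (@leq_trans (2 * ba * #|Z :\: D|)).
  apply: leq_trans nZ _; rewrite -mulnA mulnCA leq_mul2l; apply/orP; right.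
  have := cardsD Z D; have := subset_leq_card (subsetIr Z D).
  have := cardsU [set z' in Z | ~~ nr x z'] [set z' in Z | ~~ nr y z'].
  rewrite -/D -/(bz x) -/(bz y); move: #|_ :&: _| => i1; move: #|_ :&: _| => i2.
  by move: (#|D|) (#|_ :\: _|) => d e; lia.
rewrite leq_mul2l; apply/orP; right; apply/subset_leq_card/subsetP => z; rewrite !inE.
by case: (edge E (z :: S)); rewrite ?andbF //= negb_or !negbK andbT.
Qed.

(** * Trading vertices between two linear sets *)

Definition head_in (V : finType) (Z' Z : {set V}) l :=
  if l is x :: l' then (x \in Z') && all (mem Z) l' else true.

Definition denseE k cc g (V : finType) (E : {set {set V}}) := forall Z Z' : {set V},
  #|V| <= cc * #|Z| -> #|V| <= cc * #|Z'| -> Many g k (fun l => edge E l && head_in Z' Z l).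

(** An empty block would make [Blow] vacuous; with positive block sizes a transversal exists. *)
Lemma Blow_const (V : finType) sz Q (l : seq V) : all (leq 1) sz -> size l = sumn sz ->
  Blow sz (fun=> Q) l -> Q.
Proof.
elim: sz Q l => [|N sz IH] Q l //= /andP[N0 h] sl /IH H.
have {H} : all (fun=> Q) (take N l) by apply: H; rewrite // size_drop sl addKn.
by case: N N0 sl => // N _; case: l => //= x l _ /andP[].
Qed.

Lemma Blow_all (V : finType) sz (Z : {set V}) (l : seq V) : all (leq 1) sz -> size l = sumn sz ->
  Blow sz (all (mem Z)) l -> all (mem Z) l.
Proof.
elim: sz l => [|N sz IH] l /=; first by case: l.
move=> /andP[N0 h] sl B; rewrite -(cat_take_drop N l) all_cat.
have sd : size (drop N l) = sumn sz by rewrite size_drop sl addKn.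
apply/andP; split.
  apply: (Blow_const h sd); apply: Blow_impl B => r _ /allP H.
  by apply/allP => x /H /= /andP[].
apply: IH => //; apply: Blow_impl B => r _.
by case: N N0 sl {sd} => // N _; case: l => //= x l _ /andP[/andP[]].
Qed.

Lemma Blow_head_in (V : finType) a sz (Z Z' : {set V}) (l : seq V) : all (leq 1) (a :: sz) ->
  size l = sumn (a :: sz) -> Blow (a :: sz) (head_in Z' Z) l ->
  all (mem Z') (take a l) && all (mem Z) (drop a l).
Proof.
move=> /= /andP[a0 h] sl B.
have sd : size (drop a l) = sumn sz by rewrite size_drop sl addKn.
apply/andP; split.
  apply: (Blow_const h sd); apply: Blow_impl B => r _ /allP H.
  by apply/allP => x /H /= /andP[].
apply: (Blow_all h sd); apply: Blow_impl B => r _.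
by case: a a0 sl {sd} => // N _; case: l => //= x l _ /andP[/andP[]].
Qed.

Lemma exchange_perm (VF : finType) (EF : {set {set VF}}) (V : finType) (E : {set {set V}}) b s u u' v v' :
  perm_eq u u' -> perm_eq v v' -> exchange EF E b s u v -> exchange EF E b s u' v'.
Proof.
move=> pu pv; apply: Many_impl => // S _.
have pS w w' : perm_eq w w' -> tileable EF E (S ++ w) = tileable EF E (S ++ w').
  by move=> p; apply: tileable_perm; rewrite perm_cat2l.
by rewrite (pS _ _ pu) (pS _ _ pv).
Qed.

Lemma Many_in (V : finType) c d (Z : {set V}) : #|V| <= c * #|Z| ->
  Many c d (all (mem Z)).
Proof. by move=> h; apply: Many_all; rewrite (eq_card (B := mem Z)) // => x; rewrite !inE. Qed.

Section Transfer.
Variables (k : nat) (VF : finType) (EF : {set {set VF}}).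
Hypotheses (k1 : 1 < k) (EF0 : EF != set0).

Definition closedZ cz b s (V : finType) (E : {set {set V}}) (Z : {set V}) :=
  #|V| <= cz * #|Z| /\
  forall x y, x \in Z -> y \in Z -> x != y -> exchange EF E b s [:: x] [:: y].

Variables (cz bz sz g : nat).

Definition transfer d := exists s b n0, forall (V : finType) (E : {set {set V}}),
  uniform k E -> denseE k cz g E -> n0 <= #|V| -> forall Z Z' : {set V},
  closedZ cz bz sz E Z -> closedZ cz bz sz E Z' -> forall u u', size u = d -> size u' = d ->
  {subset u <= Z} -> {subset u' <= Z'} -> uniq (u ++ u') -> exchange EF E b s u u'.

Lemma transfer0 : transfer 0.
Proof. by exists 0, 1, 0 => V E _ _ _ Z Z' _ _ [|//] [|//] *; rewrite /exchange /= tileable_nil. Qed.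

(** [u] is padded with [d2] vertices of [Z] and [u'] with [d2] vertices of [Z']. The padded lists
    are exchanged by [transfer d1], and the paddings cancel by [transfer d2]. *)
Lemma transfer_sub d1 d2 : d2 <= d1 -> transfer d1 -> transfer d2 -> transfer (d1 - d2).
Proof.
move=> d12 [s1 [b1 [n1 h1]]] [s2 [b2 [n2 h2]]].
exists (d2 + d2 + s1 + s2), (4 * (cz + b1 + b2)),
  (n1 + n2 + 4 * (cz + b1 + b2) * (d1 + d1 + (d2 + d2) + s1 + s2)).
move=> V E hU hD hn Z Z' cZ cZ' u u' su su' uZ uZ' un.
pose P w := all (mem Z) (take d2 w) && all (mem Z') (drop d2 w).
apply: (exchange_cancel (d := d2) (P := P)) => //.
- apply: leq_trans hn; apply: leq_trans (leq_addl _ _); apply: leq_mul => //.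
  by rewrite size_cat su su'; lia.
- rewrite Many_cat; apply: Many_impl (Many_in d2 (proj1 cZ)) => // l sl lZ.
  apply: Many_impl (Many_in d2 (proj1 cZ')) => // l' sl' lZ'.
  by rewrite /P -sl take_size_cat // drop_size_cat // lZ.
move=> w sw /andP[/allP wZ /allP wZ'] uw.
have st : size (take d2 w) = d2 by apply: size_takel; lia.
have sd : size (drop d2 w) = d2 by rewrite size_drop; lia.
split.
  apply: (h1 V E hU hD _ Z Z') => //; first by (apply: leq_trans hn; clear; lia).
  - by rewrite size_cat su st subnK.
  - by rewrite size_cat su' sd subnK.
  - by move=> x; rewrite mem_cat => /orP[/uZ|/wZ].
  - by move=> x; rewrite mem_cat => /orP[/uZ'|/wZ'].
  rewrite (perm_uniq (s2 := w ++ u ++ u')) //.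
  rewrite -[X in perm_eq _ (X ++ _)](cat_take_drop d2 w); apply/seq.permP => p /=; rewrite !count_cat; clear; lia.
apply: (h2 V E hU hD _ Z Z') => //; first by (apply: leq_trans hn; clear; lia).
by rewrite cat_take_drop; move: uw; rewrite cat_uniq => /andP[].
Qed.

(** Euclid's algorithm by repeated subtraction. *)
Lemma transfer_gcd d1 d2 : transfer d1 -> transfer d2 -> transfer (gcdn d1 d2).
Proof.
have [N] := ubnP (d1 + d2); elim: N d1 d2 => // N IH d1 d2 hN t1 t2.
wlog d12 : d1 d2 hN t1 t2 / d1 <= d2.
  by move=> H; case: (leqP d1 d2) => [|/ltnW] ?; [|rewrite gcdnC]; apply: H => //; rewrite addnC.
have [d1_0|d1_0] := posnP d1; first by rewrite d1_0 gcd0n.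
rewrite -{1}(subnKC d12) gcdnDl; apply: IH => //; first by lia.
exact: transfer_sub.
Qed.

(** [head_in] singles out the first coordinate only, so the chosen class is moved to the front by
    renaming the classes. *)
Lemma class_sizes_perm (c : {ffun VF -> 'I_k}) i : realisation EF c ->
  exists c' : {ffun VF -> 'I_k}, realisation EF c' /\ exists r, class_sizes c' = #|vclass c i| :: r.
Proof.
case: k k1 c i => // k' _ c i hc.
have tE (v : VF) j : (tperm i ord0 (c v) == j) = (c v == tperm i ord0 j).
  by apply/eqP/eqP => [<-|->]; rewrite tpermK.
exists [ffun v => tperm i ord0 (c v)]; split.
  apply/forall_inP => e eE; apply/forallP => j.
  have /forall_inP/(_ e eE)/forallP/(_ (tperm i ord0 j)) := hc.
  suff -> : [set x in e | c x == tperm i ord0 j] = [set x in e | [ffun v => tperm i ord0 (c v)] x == j] by [].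
  by apply/setP => x; rewrite !inE ffunE tE.
rewrite /class_sizes enum_ordSl /=; eexists; congr (_ :: _).
by apply: eq_card => x; rewrite !inE ffunE tE tpermR.
Qed.

(* For copies T = X1 ++ X2 and T' = X1' ++ X2', the lists u ++ T' and X1 ++ u' ++ X2
   are exchangeable entry by entry within Z or within Z'; T' cancels against T. *)
Lemma transfer_class (c : {ffun VF -> 'I_k}) i :
  realisation EF c -> transfer #|vclass c i|.
Proof.
move=> /(class_sizes_perm i)[c' [hc' [r hr]]]; move: #|vclass c i| hr => a hr.
have hpos := class_sizes_pos hc' EF0; have sm := sumn_class_sizes c'; have ss := size_class_sizes c'.
have Bl V E l := @Blow_spans_copy _ _ _ _ hc' V E l.
rewrite hr in hpos sm ss Bl.
set m := #|VF| in sm Bl.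
have m0 : 0 < m by rewrite -sm /=; case/andP: hpos => ? _; rewrite addn_gt0; apply/orP; left.
have [b hb] := Many_Blow g (a :: r); rewrite ss sm in hb.
have [b1 [n1 L1]] := exchange_lift EF bz sz a.
have [b2 [n2 L2]] := exchange_lift EF bz sz (m - a).
set s1 := a * sz in L1; set s2 := (m - a) * sz in L2.
set b3 := 2 * (b1 + b1); set b4 := 2 * (b3 + b2).
exists (m + m + (s1 + s1 + s2) + 0), (4 * (b + b4 + 1)),
 (n1 + n2 + b3 * (4 * m + s1 + s1) + b4 * (8 * m + (s1 + s1) + s2) +
   4 * (b + b4 + 1) * (a + a + (m + m) + (s1 + s1 + s2) + 0)).
have am : a <= m by rewrite -sm /= leq_addr.
move=> V E hU hD hn Z Z' cZ cZ' u u' su su' uZ uZ' un.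
(* Two copies of F serve as paddings: the first, [T'], has its first class in [Z']; the second, [T],
   lies in [Z]. *)
pose P w := Blow (a :: r) (fun l => edge E l && head_in Z' Z l) (take m w) &&
            Blow (a :: r) (fun l => edge E l && head_in Z Z l) (drop m w).
apply: (exchange_cancel (d := m) (P := P)) => //.
- apply: leq_trans hn; apply: leq_trans (leq_addl _ _); apply: leq_mul => //.
  by rewrite size_cat su su'; lia.
- rewrite Many_cat; apply: Many_impl (hb V _ (hD Z Z' (proj1 cZ) (proj1 cZ'))) => // l sl lB.
  apply: Many_impl (hb V _ (hD Z Z (proj1 cZ) (proj1 cZ))) => // l' sl' lB'.
  by rewrite /P -sl take_size_cat // drop_size_cat // lB.
move=> w sw /andP[B' B] uw.
have st : size (take m w) = m by apply: size_takel; lia.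
have sd : size (drop m w) = m by rewrite size_drop; lia.
move: B B' uw; rewrite -{3}(cat_take_drop m w).
move: (take m w) (drop m w) st sd => T' T sT' sT B B' uw.
have tlT t Z1 : size t = m -> uniq t -> Blow (a :: r) (fun l => edge E l && head_in Z1 Z l) t ->
    tileable EF E t /\ all (mem Z1) (take a t) && all (mem Z) (drop a t).
  move=> st ut Bt; split.
    apply: tileable_copy => //; apply: Bl => //.
    by apply: Blow_impl Bt => x _ /andP[].
  apply: (Blow_head_in hpos); first by rewrite sm.
  by apply: Blow_impl Bt => x _ /andP[].
have [uT' uT] : uniq T' /\ uniq T.
  by move: uw; rewrite !cat_uniq -!andbA => /and5P[-> _ ->].
have [tT /andP[/allP TZ /allP TZ2]] := tlT _ _ sT uT B.
have [tT' /andP[/allP TZ' /allP TZ2']] := tlT _ _ sT' uT' B'.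
(* Both copies are tileable alone, so they are exchangeable with an empty witness. *)
split; last by rewrite /exchange /= tT tT'.
have sX1 : size (take a T) = a by apply: size_takel; rewrite sT.
have sX1' : size (take a T') = a by apply: size_takel; rewrite sT'.
have sX2 : size (drop a T) = m - a by rewrite size_drop sT.
have sX2' : size (drop a T') = m - a by rewrite size_drop sT'.
move: uw; rewrite -(cat_take_drop a T) -(cat_take_drop a T').
move: (take a T) (drop a T) (take a T') (drop a T') sX1 sX1' sX2 sX2' TZ TZ2 TZ' TZ2'.
move=> X1 X2 X1' X2' sX1 sX1' sX2 sX2' TZ TZ2 TZ' TZ2' uw.
have neq p q x y : uniq (p ++ q) -> x \in p -> y \in q -> x != y.
  move=> pq xp yq; apply: contraTneq pq => xy; rewrite cat_uniq negb_and; apply/orP; right.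
  by rewrite negb_and; apply/orP; left; rewrite negbK; apply/hasP; exists y => //=; rewrite -xy.
have sub3 p q rest : perm_eq ((p ++ q) ++ rest) (((X1' ++ X2') ++ X1 ++ X2) ++ u ++ u') -> uniq (p ++ q).
  by move=> /perm_uniq h; move: uw; rewrite -h cat_uniq => /andP[].
have u1 : uniq (u ++ X1).
  by apply: (sub3 _ _ (X1' ++ X2' ++ X2 ++ u')); apply/seq.permP => p /=; rewrite !count_cat; clear; lia.
have u2 : uniq (X1' ++ u').
  by apply: (sub3 _ _ (X1 ++ X2' ++ X2 ++ u)); apply/seq.permP => p /=; rewrite !count_cat; clear; lia.
have u3 : uniq (X2' ++ X2).
  by apply: (sub3 _ _ (X1 ++ X1' ++ u' ++ u)); apply/seq.permP => p /=; rewrite !count_cat; clear; lia.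
have u4 : uniq (u ++ X1').
  by apply: (sub3 _ _ (X1 ++ X2' ++ X2 ++ u')); apply/seq.permP => p /=; rewrite !count_cat; clear; lia.
have u5 : uniq (X1 ++ u').
  by apply: (sub3 _ _ (X1' ++ X2' ++ X2 ++ u)); apply/seq.permP => p /=; rewrite !count_cat; clear; lia.
have u6 : uniq ((u ++ X1') ++ X2').
  by apply: (sub3 _ _ (X1 ++ X2 ++ u')); apply/seq.permP => p /=; rewrite !count_cat; clear; lia.
have u7 : uniq ((X1 ++ u') ++ X2).
  by apply: (sub3 _ _ (X1' ++ X2' ++ u)); apply/seq.permP => p /=; rewrite !count_cat; clear; lia.
(* The pairs are [u] with [X1] and [X2'] with [X2], both inside [Z], and [X1'] with [u'] inside
   [Z']. *)
apply: (@exchange_perm _ _ _ _ _ _ ((u ++ X1') ++ X2') _ ((X1 ++ u') ++ X2)).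
- by rewrite catA.
- by apply/seq.permP => p /=; rewrite !count_cat; clear; lia.
have hX1 x y : x \in u -> y \in X1 -> exchange EF E bz sz [:: x] [:: y].
  move=> xu yX; apply: (proj2 cZ); [exact: uZ | exact: TZ | exact: (neq _ _ _ _ _ u1)].
have hX1' x y : x \in X1' -> y \in u' -> exchange EF E bz sz [:: x] [:: y].
  move=> xu yX; apply: (proj2 cZ'); [exact: TZ' | exact: uZ' | exact: (neq _ _ _ _ _ u2)].
have hX2 x y : x \in X2' -> y \in X2 -> exchange EF E bz sz [:: x] [:: y].
  move=> xu yX; apply: (proj2 cZ); [exact: TZ2' | exact: TZ2 | exact: (neq _ _ _ _ _ u3)].
apply: exchange_cat => //.
- apply: leq_trans hn; rewrite -/b4 !size_cat su su' sX1 sX1' sX2 sX2'.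
  apply: (@leq_trans (b4 * (8 * m + (s1 + s1) + s2))).
    by apply: leq_mul => //; move: (s1) (s2) (m) am => t1 t2 t; clear; lia.
  by move: (b4 * _) (b3 * _) (4 * _ * _) => t1 t2 t; clear; lia.
- apply: exchange_cat => //; last by apply: L1 => //; apply: leq_trans hn; clear; lia.
    apply: leq_trans hn; rewrite -/b3 !size_cat su su' sX1 sX1'.
    apply: (@leq_trans (b3 * (4 * m + s1 + s1))).
      by apply: leq_mul => //; move: (s1) (m) am => t1 t; clear; lia.
    by move: (b4 * _) (b3 * _) (4 * _ * _) => t1 t2 t; clear; lia.
  by apply: L1 => //; apply: leq_trans hn; clear; lia.
by apply: L2 => //; apply: leq_trans hn; clear; lia.
Qed.

Lemma transfer_gcdS : gcdS k EF = 1 -> transfer 1.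
Proof.
move=> <-; rewrite /gcdS; elim/big_ind: _ => [|d1 d2|s].
- exact: transfer0.
- exact: transfer_gcd.
by case/existsP => c /andP[hc /existsP[i /eqP <-]]; apply: transfer_class.
Qed.

End Transfer.

Lemma near_sym k b (V : finType) (E : {set {set V}}) x y : near k b E x y -> near k b E y x.
Proof. by apply: Many_impl => // S _; rewrite andbC. Qed.

(** The chain is w, z, z', y: [z] is near [w], [z'] is near [y], and z, z' are linked by
    [transfer 1] between the sets [Z] of [w] and [Z'] of [y]. The size constant [cz] precedes [g]
    because the density proportion depends on the size of the sets tested. *)
Lemma exchange_all k (VF : finType) (EF : {set {set VF}}) ba : 1 < k -> EF != set0 ->
  kpartite k EF -> gcdS k EF = 1 ->
  exists cz, forall g, exists s b n0, forall (V : finType) (E : {set {set V}}),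
    uniform k E -> codegE k ba E -> denseE k cz g E -> n0 <= #|V| ->
    forall x y, x != y -> exchange EF E b s [:: x] [:: y].
Proof.
move=> k1 EF0 [c hc] hg; have [b0 [cz hZ]] := near_set ba k1.
exists cz => g.
have [s1 [b1 [n1 h1]]] := near_exchange b0 ba hc EF0 (ltnW k1).
set bz := 4 * (cz + b1 + b1); set sz := 1 + s1 + s1.
have [s2 [b2 [n2 h2]]] := transfer_gcdS k1 EF0 cz bz sz g hg.
set b3 := 4 * (cz + b2 + b1); set s3 := 1 + s2 + s1.
set b4 := 4 * (cz + b1 + b3); set s4 := 1 + s1 + s3.
exists s4, b4, (2 * k + n1 + n2 + bz * (2 + sz) + b3 * (2 + s3) + b4 * (2 + s4)).
move=> V E hU hcd hD hn w y wy.
have hk : 2 * k <= #|V| by lia.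
have near1 x z : x != z -> near k b0 E x z -> exchange EF E b1 s1 [:: x] [:: z].
  by apply: h1 => //; lia.
(* Two members of [Z] are exchanged through a third vertex that is near to both. *)
have clo (Z : {set V}) : #|V| <= cz * #|Z| -> (forall x z, x \in Z -> z \in Z ->
       #|V| <= cz * #|[set t | near k b0 E x t && near k b0 E z t]|) ->
    closedZ EF cz bz sz E Z.
  move=> nZ hZZ; split => // x z xZ zZ xz.
  apply: (@exchange_trans _ _ _ _ cz b1 b1 1 s1 s1 (fun l => all (mem [set t | near k b0 E x t && near k b0 E z t]) l)) => //.
  - by apply: leq_trans hn; rewrite -/bz; apply: (@leq_trans (bz * (2 + sz))); rewrite /=; first (apply: leq_mul => //; rewrite /sz); lia.
  - exact: Many_in (hZZ _ _ xZ zZ).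
  move=> [|t [|]] //= _; rewrite !inE !andbT => /andP[xt zt] tx tz.
  split; first by apply: near1 => //; rewrite eq_sym.
  by apply: near1 => //; apply: near_sym.
have [Z [nZ wZ ZZ]] := hZ V E hU hcd hk w.
have [Z' [nZ' yZ' ZZ']] := hZ V E hU hcd hk y.
apply: (@exchange_trans _ _ _ _ cz b1 b3 1 s1 s3 (all (mem Z))) => //.
- by apply: leq_trans hn; rewrite -/b4; apply: (@leq_trans (b4 * (2 + s4))); rewrite /=; first (apply: leq_mul => //; rewrite /s4); lia.
- exact: Many_in.
move=> [|z [|]] //= _; rewrite !inE !andbT => zZ zw zy.
split; first by apply: near1; [rewrite eq_sym | apply: wZ].
apply: (@exchange_trans _ _ _ _ cz b2 b1 1 s2 s1 (all (mem Z'))) => //.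
- by apply: leq_trans hn; rewrite -/b3; apply: (@leq_trans (b3 * (2 + s3))); rewrite /=; first (apply: leq_mul => //; rewrite /s3); lia.
- exact: Many_in.
move=> [|z' [|]] //= _; rewrite !inE !andbT => zZ' zz' zy'.
split; last by apply: near1 => //; apply: near_sym; apply: yZ'.
apply: (h2 V E hU hD _ Z Z') => //; first by (apply: leq_trans hn; clear; lia).
- exact: clo.
- exact: clo.
- by move=> x; rewrite inE => /eqP ->.
- by move=> x; rewrite inE => /eqP ->.
by rewrite /= inE eq_sym zz'.
Qed.

(** * Numerical estimates and selection of disjoint absorbers *)

Lemma leq_expn2r m n e : m <= n -> m ^ e <= n ^ e.
Proof. by move=> mn; case: e => // e; rewrite leq_exp2r. Qed.

(** Bernoulli's inequality. It is used with x + 1 = 2B, as (1 - 1/(2B))^(2B) <= 1/2. *)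
Lemma bernoulli2 x : 0 < x -> 2 * x ^ x.+1 <= x.+1 ^ x.+1.
Proof.
move=> x0; have H y : x ^ y * (x + y) <= x * x.+1 ^ y.
  elim: y => [|y IH]; first by rewrite !expn0 addn0 mul1n muln1.
  apply: (@leq_trans (x ^ y * (x + y) * x.+1)); last by rewrite expnSr mulnA leq_mul2r IH orbT.
  by rewrite expnSr -!mulnA leq_mul2l; apply/orP; right; nia.
rewrite -(leq_pmul2l x0); apply: leq_trans (H x.+1).
by rewrite mulnA [X in _ <= X]mulnC leq_mul2r; apply/orP; right; lia.
Qed.

Lemma expn_poly m K : 0 < K -> exists n0, forall n, n0 <= n -> n ^ m <= 2 ^ (n %/ K).
Proof.
(* With q = n %/ D, the threshold gives q >= D and hence n <= 2^(2q); since D exceeds 2Km, the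
   exponent 2qm is at most n %/ K. *)
move=> K0; pose D := (2 * K * m).+1; exists (D * D) => n hn.
pose q := n %/ D.
have qD : D <= q by rewrite leq_divRL.
have nq : n < D * q.+1 by rewrite mulnC ltn_ceil.
have n2 : n <= 2 ^ (2 * q).
  apply: leq_trans (ltnW nq) _; rewrite mul2n -addnn expnD; apply: leq_mul.
    by apply: leq_trans qD (ltnW _); apply: ltn_expl.
  exact: ltn_expl.
apply: (@leq_trans ((2 ^ (2 * q)) ^ m)); first exact: leq_expn2r.
rewrite -expnM leq_exp2l // leq_divRL //.
apply: leq_trans (leq_trunc_div n D); rewrite -/q /D; nia.
Qed.

Section Select.
Variables (V : finType) (ab : seq V -> seq V -> bool) (m s B N : nat).
Hypotheses (n0 : 0 < #|V|) (mn : m <= #|V|).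
Hypothesis hab : forall R, uniq R -> size R = m -> forall U : {set V}, #|U| <= s * N ->
  #|V| ^ s <= B * Sum s (fun l => [&& ab l R, uniq l & ~~ has (mem U) l]).

Definition weight (A : seq (seq V)) :=
  Sum m (fun R => uniq R * 2 ^ count (fun l => ~~ ab l R) A).

Lemma weight_pos A : 0 < weight A.
Proof.
have H : forall P : seq V -> nat, (exists2 R, size R = m & 0 < P R) -> 0 < Sum m P.
  elim: (m) => [|m' IH] P [R]; first by move/size0nil ->.
  case: R => // x R [sR] PR /=; rewrite (bigD1 x) //= addn_gt0 IH //.
  by exists R.
apply: H; exists (take m (enum V)); first by apply: size_takel; rewrite -cardE.
by rewrite muln_gt0 expn_gt0 /= take_uniq ?enum_uniq.
Qed.

(* Derandomised selection: appending l doubles the weight of every R that l does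
   not absorb, so an l that is at least as good as the average multiplies the
   total weight by at most (2B-1)/B. *)
Lemma select t : t <= N -> exists A : seq (seq V), [/\ size A = t,
   all (fun l => size l == s) A, uniq (flatten A),
   (forall l, l \in A -> exists R, ab l R) &
   B ^ t * weight A <= (2 * B - 1) ^ t * #|V| ^ m].
Proof.
elim: t => [|t IH] tN.
  exists [::]; split => //; rewrite !mul1n /weight.
  apply: leq_trans (_ : Sum m (fun=> 1) <= _); last by rewrite Sum_const muln1.
  by apply: leq_Sum => R _ /=; case: (uniq R).
have [A [sA hA uA aA wA]] := IH (ltnW tN).
pose U := [set x in flatten A].
have hU : #|U| <= s * N.
  apply: leq_trans (card_set_in_le _) _; rewrite size_flatten.
  have -> : shape A = nseq t s.
    rewrite -sA; elim: (A) hA => //= l A' IHA /andP[/eqP -> /IHA ->] //.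
  by rewrite sumn_nseq; apply: leq_mul => //; apply: ltnW.
pose w R := uniq R * 2 ^ count (fun l => ~~ ab l R) A.
pose ok l := uniq l && ~~ has (mem U) l.
have B0 : 0 < B.
  have u := take_uniq m (enum_uniq V); have := hab u _ hU.
  rewrite size_takel -?cardE // => /(_ erefl); case: (B) => //; rewrite mul0n leqn0.
  by rewrite expn_eq0 eqn0Ngt n0.
(* On average over [l] the absorbed weight is at least weight A / B, by [hab] summed over [R]. The
   left side does not depend on [l], and [.+1] supplies the strictness. *)
have [l sl] : exists2 l, size l = s &
   weight A < (B * Sum m (fun R => [&& ab l R & ok l] * w R)).+1.
  apply: Sum_ltP; rewrite Sum_const.
  rewrite (eq_Sum (G := fun l => 1 + B * Sum m (fun R => [&& ab l R & ok l] * w R))) //.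
  rewrite Sum_add Sum_const muln1 Sum_mull Sum_exchange -Sum_mull.
  apply: (@leq_ltn_trans (Sum m (fun R => #|V| ^ s * w R))).
    by rewrite Sum_mull.
  apply: (@leq_ltn_trans (Sum m (fun R => B * Sum s (fun l => [&& ab l R & ok l] * w R)))); last first.
    by rewrite -{1}[Sum m _]add0n ltn_add2r expn_gt0 n0.
  apply: leq_Sum => R sR; rewrite Sum_mulr mulnA leq_mul2r.
  by apply/orP; have [uR|nuR] := boolP (uniq R); [right; exact: hab | left; rewrite /w (negPf nuR)].
rewrite ltnS => hl.
(* The absorbed weight is positive, so [l] absorbs some [R0], and [ok l] holds as well. *)
have /Sum_pos[R0 sR0 hR0] : 0 < Sum m (fun R => [&& ab l R & ok l] * w R).
  by rewrite lt0n; apply: contraTneq hl => ->; rewrite muln0 -ltnNge weight_pos.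
have /andP[aR0 okl] : ab l R0 && ok l by case: (_ && _) hR0.
exists (l :: A); split => //=; first by rewrite sA.
- by rewrite sl eqxx.
- case/andP: okl => ul /hasPn h; rewrite cat_uniq ul uA andbT /=.
  by apply/hasPn => x xA; apply/negP => /h /=; rewrite inE xA.
- by move=> l'; rewrite inE => /orP[/eqP ->|/aA //]; exists R0.
have E : weight (l :: A) + Sum m (fun R => [&& ab l R & ok l] * w R) = 2 * weight A.
  rewrite /weight -Sum_add -Sum_mull; apply: eq_Sum => R _; rewrite /= okl andbT /w.
  by case: (ab l R); rewrite /= ?add0n ?mul0n ?mul1n ?addn0 ?expnD ?mul2n ?addnn //; lia.
have E2 : B * weight (l :: A) <= (2 * B - 1) * weight A by nia.
rewrite !expnSr -[X in X <= _]mulnA.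
apply: (@leq_trans (B ^ t * ((2 * B - 1) * weight A))); first by rewrite leq_mul2l E2 orbT.
by rewrite mulnCA -[X in _ <= X]mulnA [X in _ <= X]mulnCA leq_mul2l wA orbT.
Qed.

(** The term of a single [R] is at most the whole weight, which bounds the number of members of [A]
    that fail to absorb it. *)
Lemma select_count A R : size A = N -> B ^ N * weight A <= (2 * B - 1) ^ N * #|V| ^ m ->
  uniq R -> size R = m ->
  B ^ N * 2 ^ N <= (2 * B - 1) ^ N * #|V| ^ m * 2 ^ count (fun l => ab l R) A.
Proof.
move=> sA wA uR sR.
have H : 2 ^ count (fun l => ~~ ab l R) A <= weight A.
  rewrite /weight; have L F : F R <= Sum m F.
    elim: (m) R F sR {uR} => [|m' IH] [|x R] F //= [sR].
    by rewrite (bigD1 x) //=; apply: leq_trans (leq_addr _ _); apply: IH sR.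
  by apply: leq_trans (L _); rewrite uR mul1n.
have -> : 2 ^ N = 2 ^ count (fun l => ~~ ab l R) A * 2 ^ count (fun l => ab l R) A.
  by rewrite -expnD addnC -sA -(count_predC (fun l => ab l R)).
rewrite mulnA leq_mul2r; apply/orP; right.
by apply: leq_trans wA; rewrite leq_mul2l H orbT.
Qed.

End Select.

(** * Absorption, greedy tiling and assembly of the factor *)

Section Absorb.
Variables (VF : finType) (EF : {set {set VF}}) (V : finType) (E : {set {set V}}).

Definition absorb l R := tileable EF E l && tileable EF E (l ++ R).

Lemma tileable_flatten A : (forall l, l \in A -> tileable EF E l) -> uniq (flatten A) -> tileable EF E (flatten A).
Proof.
elim: A => [|l A IH] h u /=; first exact: tileable_nil.
apply: tileable_cat => //; first by apply: h; rewrite mem_head.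
apply: IH; first by move=> l' h'; apply: h; rewrite inE h' orbT.
by move: u; rewrite /= cat_uniq => /and3P[].
Qed.

(** Each block of [W] uses up one member of [A], which lowers the count of every other [R] by at
    most one; so [q] absorbers per [R] suffice for [q] blocks. *)
Lemma absorb_all q A W : uniq (flatten A ++ W) -> (forall l, l \in A -> tileable EF E l) ->
  size W = #|VF| * q ->
  (forall R, uniq R -> size R = #|VF| -> q <= count (fun l => absorb l R) A) ->
  tileable EF E (flatten A ++ W).
Proof.
elim: q A W => [|q IH] A W uAW hA sW hc.
  move: sW uAW; rewrite muln0 => /size0nil ->; rewrite cats0; exact: tileable_flatten.
have mW : #|VF| <= size W by rewrite sW mulnS leq_addr.
have uW : uniq W by move: uAW; rewrite cat_uniq => /and3P[].
have uR := take_uniq #|VF| uW; have sR := size_takel mW.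
have : has (fun l => absorb l (take #|VF| W)) A by rewrite has_count; apply: leq_trans (hc _ uR sR).
case/hasP => l lA /andP[_ aR].
have p := perm_to_rem lA.
have pp : perm_eq (flatten A ++ W)
    ((l ++ take #|VF| W) ++ (flatten (rem l A) ++ drop #|VF| W)).
  have /permPl p1 : perm_eq (flatten A) (l ++ flatten (rem l A)) by exact: perm_flatten p.
  apply/seq.permP => P; rewrite -{1}(cat_take_drop #|VF| W) !count_cat.
  by have /seq.permP/(_ P) := perm_flatten p; rewrite /= count_cat => ->; clear; lia.
have u2 := uAW; rewrite (perm_uniq pp) in u2.
rewrite (tileable_perm _ _ pp); apply: tileable_cat => //; apply: IH.
- by move: u2; rewrite cat_uniq => /and3P[].
- by move=> l' /mem_rem; apply: hA.
- by rewrite size_drop sW mulnS addKn.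
move=> R' uR' sR'; have := hc _ uR' sR'; have /seq.permP/(_ (fun l => absorb l R')) := p.
by move=> -> /=; case: (absorb l R'); rewrite /= ?add1n ?add0n // => /ltnW.
Qed.

Lemma greedy_tiling c2 : 0 < #|VF| ->
  (forall Z : {set V}, #|V| <= c2 * #|Z| -> exists2 B : {set V}, B \subset Z & spans_copy EF E B) ->
  forall X, uniq X -> exists Y W, [/\ perm_eq X (Y ++ W), tileable EF E Y & c2 * size W < #|V|].
Proof.
move=> m0 hZ X; have [N] := ubnP (size X); elim: N X => // N IH X sX uX.
have [lt|ge] := ltnP (c2 * size X) #|V|.
  by exists [::], X; split => //; apply: tileable_nil.
have cX : #|[set x in X]| = size X by rewrite cardsE; apply/card_uniqP.
have [B BX FB] : exists2 B : {set V}, B \subset [set x in X] & spans_copy EF E B.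
  by apply: hZ; rewrite cX.
have p : perm_eq X (enum B ++ filter (fun x => x \notin B) X).
  apply: (perm_trans (y := filter (mem B) X ++ filter (predC (mem B)) X)).
    by rewrite perm_sym perm_filterC.
  rewrite perm_cat2r; apply: uniq_perm; [exact: filter_uniq | exact: enum_uniq |].
  move=> x; rewrite mem_filter mem_enum /=; have [xB|//] := boolP (x \in B).
  by have := subsetP BX x xB; rewrite inE => ->.
have sF : size (filter (fun x => x \notin B) X) < N.
  have := perm_size p; rewrite size_cat -cardE (spans_copy_card FB) => e.
  by rewrite -ltnS; apply: leq_trans sX; rewrite e ltnS; rewrite -[X in X < _]add0n ltn_add2r.
have [Y [W [pYW tY hW]]] := IH _ sF (filter_uniq _ uX).
have uB : uniq (enum B ++ Y ++ W).
  rewrite -(perm_uniq (s1 := X)) //; apply: perm_trans p _; by rewrite perm_cat2l.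
exists (enum B ++ Y), W; split => //.
  by rewrite -catA; apply: perm_trans p _; rewrite perm_cat2l.
apply: tileable_cat => //; last by move: uB; rewrite catA cat_uniq => /and3P[].
apply: tileable_copy => //; first exact: enum_uniq.
suff -> : [set x in enum B] = B by [].
by apply/setP => x; rewrite inE mem_enum.
Qed.

Lemma tileable_factor : tileable EF E (enum V) -> has_factor EF E.
Proof.
case/andP=> _ /existsP[Q /andP[/and3P[/eqP cQ tQ nQ] /forall_inP FQ]].
have hf (j : 'I_#|Q|) : exists f : {ffun VF -> V}, [&& injectiveb f, f @: VF == enum_val j &
     [forall e in EF, (f @: (e : {set VF})) \in E]].
  exact/existsP/FQ/enum_valP.
have [phi hphi] := fin_all_exists hf.
exists #|Q|, phi; split; last split.
- move=> j; case/and3P: (hphi j) => /injectiveP fi _ /forall_inP h; split => //.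
- move=> j1 j2 x1 x2 h; apply/enum_val_inj/eqP; apply: contraT => ne.
  have /trivIsetP/(_ _ _ (enum_valP j1) (enum_valP j2) ne) := tQ.
  case/and3P: (hphi j1) => _ /eqP <- _; case/and3P: (hphi j2) => _ /eqP <- _.
  rewrite -setI_eq0 => /eqP/setP/(_ (phi j1 x1)); rewrite !inE imset_f //=.
  by rewrite h imset_f.
- move=> v; have : v \in cover Q by rewrite cQ inE mem_enum.
  case/bigcupP => B BQ vB; exists (enum_rank_in BQ B).
  case/and3P: (hphi (enum_rank_in BQ B)) => _; rewrite enum_rankK_in // => /eqP h _.
  by have /imsetP[x _ ->] : v \in phi (enum_rank_in BQ B) @: VF; [rewrite h | exists x].
Qed.

(** Without edges every injection is a copy, so any bijection from blocks times [VF] onto [V] will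
    do. *)
Lemma empty_factor : #|VF| %| #|V| -> has_factor (set0 : {set {set VF}}) E.
Proof.
move=> dv; have e : #|{: 'I_(#|V| %/ #|VF|) * VF}| = #|V|.
  by rewrite card_prod card_ord divnK.
pose f p := enum_val (cast_ord e (enum_rank p)).
have fi : injective f by move=> p q /enum_val_inj/cast_ord_inj/enum_rank_inj.
exists (#|V| %/ #|VF|), (fun j x => f (j, x)); split; last split.
- by move=> j; split; [move=> x y /fi[] | move=> e'; rewrite inE].
- by move=> j1 j2 x1 x2 /fi[].
- move=> v; case E1: (enum_val (cast_ord (esym e) (enum_rank v))) => [j x].
  by exists j, x; rewrite /f -E1 enum_valK cast_ordKV enum_rankK.
Qed.

End Absorb.

Lemma denseE_le k c c' g (V : finType) (E : {set {set V}}) :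
  c <= c' -> denseE k c' g E -> denseE k c g E.
Proof.
by move=> cc h Z Z' hZ hZ'; apply: h; [apply: leq_trans hZ _|apply: leq_trans hZ' _];
  apply: leq_mul.
Qed.

(** An absorber of [R] is a copy [Y] of F together with a list [S] exchanging [R] and [Y] entry by
    entry: alone it is tiled as (S, Y), with [R] added as [Y] and (S, R). *)
Lemma absorb_Many k (VF : finType) (EF : {set {set VF}}) ba : 1 < k -> EF != set0 ->
  kpartite k EF -> gcdS k EF = 1 ->
  exists cz, forall g, exists s b n0, forall (V : finType) (E : {set {set V}}),
    uniform k E -> codegE k ba E -> denseE k cz g E -> n0 <= #|V| ->
    forall R, uniq R -> size R = #|VF| -> Many b s (fun l => absorb EF E l R).
Proof.
move=> k1 EF0 hk hg; have [cz H] := exchange_all ba k1 EF0 hk hg.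
(* The successor ensures that density also applies to the whole vertex set, even if [cz] is 0. *)
have [c hc] := hk; exists cz.+1 => g.
have [s0 [b0 [n0 h0]]] := H g; set m := #|VF|.
have [b1 hb1] := Many_Blow g (class_sizes c); rewrite size_class_sizes sumn_class_sizes in hb1.
have [b2 [n2 h2]] := exchange_lift EF b0 s0 m.
exists (m + m * s0), (2 * (b1 + b2)), (n0 + n2 + 2 * (b1 + b2) * (m + m + m * s0)).
move=> V E hU hcd hD hn R uR sR.
have m0 : 0 < m.
  case/set0Pn: EF0 => e eE; have i : 'I_k by apply: (Ordinal (ltnW k1)).
  have /forall_inP/(_ e eE)/forallP/(_ i)/cards1P[v _] := hc.
  by apply/card_gt0P; exists v.
have TV : #|V| <= cz.+1 * #|[set: V]| by rewrite cardsT leq_pmull.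
have hn0 : n0 <= #|V| by apply: leq_trans hn; clear; lia.
have hn2 : n2 <= #|V| by apply: leq_trans hn; clear; lia.
apply: (@Many_bind _ b1 b2 m (m * s0) _
   (fun Y S => tileable EF E (S ++ R) && tileable EF E (S ++ Y)) [set x in R] _ _ (hb1 V _ (hD _ _ TV TV))).
- apply: leq_trans hn; apply: leq_trans (leq_addl _ _); apply: leq_mul => //.
  by rewrite !leq_add2r -sR card_set_in_le.
- move=> Y sY _ uY hY; apply: h2 => //.
    by apply: (uniq_cat_avoid (U := [set x in Y])) => //;
      [move=> x; rewrite inE | apply/hasPn => x xR; rewrite /= inE; apply: contra hY => xY;
       apply/hasP; exists x; rewrite //= inE].
  move=> x y xR yY; apply: h0 => //; first exact: denseE_le hD.
  by apply: contraNneq hY => xy; apply/hasP; exists y; rewrite //= inE -xy.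
move=> Y S sY sS BY /andP[t1 t2] uYS hav.
have tY : tileable EF E Y.
  apply: tileable_copy => //; first by move: uYS; rewrite cat_uniq => /and3P[].
  apply: (Blow_spans_copy hc) => //; first by move: uYS; rewrite cat_uniq => /and3P[].
  by apply: Blow_impl BY => x _ /andP[].
apply/andP; split.
  by rewrite (tileable_perm _ _ (l' := S ++ Y)) // perm_catC.
rewrite -catA; apply: tileable_cat => //; rewrite catA.
by apply: (uniq_cat_avoid (U := [set x in R])) => // x; rewrite inE.
Qed.

Lemma Many_ex (V : finType) b s P : 0 < #|V| -> Many b s P -> exists2 l : seq V, size l = s & P l.
Proof.
move=> n0 /Many_Sum h; have [|l sl Pl] := @Sum_pos V s P.
  rewrite lt0n; apply: contraTneq h => ->; by rewrite muln0 -ltnNge expn_gt0 n0.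
by exists l => //; case: (P l) Pl.
Qed.

Lemma dense_copy k (VF : finType) (EF : {set {set VF}}) c2 g : 0 < k -> EF != set0 ->
  kpartite k EF -> exists n0, forall (V : finType) (E : {set {set V}}), denseE k c2 g E ->
    n0 <= #|V| -> forall Z : {set V}, #|V| <= c2 * #|Z| ->
    exists2 B : {set V}, B \subset Z & spans_copy EF E B.
Proof.
move=> k0 EF0 [c hc]; have [b hb] := Many_Blow g (class_sizes c).
have hpos := class_sizes_pos hc EF0; have ss := size_class_sizes c; have sm := sumn_class_sizes c.
have Bl V E l := @Blow_spans_copy _ _ _ _ hc V E l.
rewrite ss in hb; case: (class_sizes c) ss sm hpos Bl hb => [k_0|a r ss sm hpos Bl hb].
  by rewrite -k_0 in k0.
have m0 : 0 < #|VF| by rewrite -sm /=; case/andP: hpos => a0 _; rewrite addn_gt0 a0.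
rewrite sm in hb; exists (2 * b * #|VF|).+1 => V E hD hn Z hZ.
have h1 : 2 * b * (#|@set0 V| + #|VF|) <= #|V| by rewrite cards0; apply: ltnW.
have [|l sl /and3P[Bll ul _]] := Many_ex _ (Many_avoid h1 (hb V _ (hD Z Z hZ hZ))).
  exact: leq_trans hn.
exists [set x in l]; last first.
  by apply: Bl => //; apply: Blow_impl Bll => x _ /andP[].
have /andP[/allP h2 /allP h3] : all (mem Z) (take a l) && all (mem Z) (drop a l).
  apply: (Blow_head_in hpos); first by rewrite sm.
  by apply: Blow_impl Bll => x _ /andP[].
apply/subsetP => x; rewrite inE -(cat_take_drop a l) mem_cat => /orP[/h2|/h3] //.
Qed.

(** Density is needed at two scales. The proportion [g] at scale [cz] determines the absorbers, and
    only their capacity determines the scale [c2] to which the greedy tiling must go. *)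
Lemma factor_dense k (VF : finType) (EF : {set {set VF}}) ba : 1 < k -> EF != set0 ->
  kpartite k EF -> gcdS k EF = 1 ->
  exists cz, forall g, exists c2, forall g2, exists n0, forall (V : finType) (E : {set {set V}}),
    uniform k E -> codegE k ba E -> denseE k cz g E -> denseE k c2 g2 E -> n0 <= #|V| ->
    #|VF| %| #|V| -> has_factor EF E.
Proof.
move=> k1 EF0 hk hg; have [cz H] := absorb_Many ba k1 EF0 hk hg.
exists cz => g; have [s [b [n1 h1]]] := H g; set m := #|VF| in h1 *.
(* [B] is the cost of turning [Many] with avoidance into a count. [K] is such that [N] absorbers of
   [s] vertices occupy at most |V| / (4 * b.+1) vertices, which [Many_avoid] tolerates. *)
pose B := (2 * b.+1) ^ s; pose K := (8 * b.+1 * s * B).+1.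
exists (2 * K) => g2.
have [n2 h2] := dense_copy (2 * K) g2 (ltnW k1) EF0 hk.
have [n3 h3] := @expn_poly m (2 * K) isT.
exists (n1 + n2 + n3 + m + 4 * b.+1 * s + 1) => V E hU hcd hD hD2 hn dv.
have [hn1 hn2 hn3] : [/\ n1 <= #|V|, n2 <= #|V| & n3 <= #|V|] by split; apply: leq_trans hn; clear; lia.
have [hm hbs V0] : [/\ m <= #|V|, 4 * b.+1 * s <= #|V| & 0 < #|V|] by split; apply: leq_trans hn; clear; lia.
have m0 : 0 < m.
  rewrite lt0n; apply: contraTneq dv => ->; by rewrite dvd0n -lt0n.
set h := #|V| %/ K; pose N := 2 * B * h.
have hKh : K * h <= #|V| by rewrite mulnC leq_trunc_div.
have B0 : 0 < B by rewrite expn_gt0.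
have [B1 B2] : (2 * B - 1).+1 = 2 * B /\ 0 < 2 * B - 1 by move: (B) B0; clear; lia.
have hab R : uniq R -> size R = m -> forall U : {set V}, #|U| <= s * N ->
  #|V| ^ s <= B * Sum s (fun l => [&& absorb EF E l R, uniq l & ~~ has (mem U) l]).
  move=> uR sR U hUN; apply: Many_Sum; apply: Many_avoid; last first.
    by apply: Many_impl (h1 V E hU hcd hD hn1 R uR sR) => //.
  have : 2 * (2 * b.+1 * (#|U| + s)) <= 2 * #|V|; last by rewrite leq_mul2l.
  have : 4 * b.+1 * #|U| <= 4 * b.+1 * (s * N) by rewrite leq_mul2l hUN orbT.
  have : 4 * b.+1 * (s * N) <= K * h by rewrite /N /K; nia.
  by move: hKh hbs; clear; nia.
have [A [sA sA' uA aA wA]] := select V0 hm hab (leqnn N).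
have hcount R : uniq R -> size R = m -> #|V| %/ (2 * K) <= count (fun l => absorb EF E l R) A.
  move=> uR sR; have := select_count sA wA uR sR; set cR := count _ _; rewrite -expnMn => hc.
  (* Since N = 2Bh, the selection bound gives 2^h <= |V|^m * 2^cR. With |V|^m <= 2^q, where q = |V|
     %/ (2K) and 2q <= h, at least q absorbers remain. *)
  have b2 : 2 ^ h * (2 * B - 1) ^ N <= (B * 2) ^ N.
    rewrite /N !(expnM _ (2 * B)) -expnMn; apply: leq_expn2r.
    by have := bernoulli2 B2; rewrite B1 (mulnC B).
  have : 2 ^ h * (2 * B - 1) ^ N <= (#|V| ^ m * 2 ^ cR) * (2 * B - 1) ^ N.
    by apply: leq_trans b2 (leq_trans hc _); rewrite -mulnA mulnC.
  rewrite leq_mul2r expn_eq0 (gtn_eqF B2) /= => h4; have := h3 _ hn3; set q := #|V| %/ (2 * K) => h5.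
  have : 2 ^ h <= 2 ^ (q + cR) by apply: leq_trans h4 _; rewrite expnD leq_mul2r h5 orbT.
  rewrite leq_exp2l // => h6.
  have : 2 * q <= h by rewrite /q /h (mulnC 2 K) divnMA mulnC leq_trunc_div.
  by move: h6; clear; lia.
have tA l : l \in A -> tileable EF E l by case/aA => R /andP[].
have [Y [W [pX tY sW]]] := greedy_tiling m0 (h2 V E hD2 hn2)
   (filter_uniq (fun x => x \notin flatten A) (enum_uniq V)).
have pV : perm_eq (enum V) ((flatten A ++ W) ++ Y).
  apply: (perm_trans (y := flatten A ++ filter (fun x => x \notin flatten A) (enum V))).
    apply: uniq_perm; first exact: enum_uniq.
      rewrite cat_uniq uA filter_uniq ?enum_uniq // andbT.
      by apply/hasPn => x; rewrite mem_filter => /andP[].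
    by move=> x; rewrite mem_cat mem_filter mem_enum andbT orbN.
  by rewrite -catA perm_cat2l; apply: perm_trans pX _; rewrite perm_catC.
have uV : uniq ((flatten A ++ W) ++ Y) by rewrite -(perm_uniq pV) enum_uniq.
have tfA : tileable EF E (flatten A) by exact: tileable_flatten.
have dW : m %| size W.
  have := perm_size pV; rewrite -cardE !size_cat => e; move: dv; rewrite e.
  by rewrite dvdn_addl ?(tileable_size tY) // dvdn_addr ?(tileable_size tfA).
apply: tileable_factor; rewrite (tileable_perm _ _ pV); apply: tileable_cat => //.
apply: (@absorb_all _ _ _ _ (size W %/ m)) => //.
- by move: uV; rewrite (cat_uniq (_ ++ _)) => /and3P[].
- by rewrite mulnC divnK.
move=> R uR sR; apply: leq_trans (hcount R uR sR).
apply: leq_trans (leq_div _ _) _.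
by rewrite leq_divRL // mulnC; apply: ltnW.
Qed.

(* From real density and codegree to natural reciprocals *)
Delimit Scope R_scope with real.

Lemma INR_leq m n : m <= n -> Rle (INR m) (INR n).
Proof. by move=> /leP; apply: le_INR. Qed.

Lemma leq_INR m n : Rle (INR m) (INR n) -> m <= n.
Proof. by move=> /INR_le/leP. Qed.

Lemma INR_expn_pos m n : 0 < m -> Rlt 0 (INR (m ^ n)).
Proof. by move=> m0; apply: lt_0_INR; apply/ltP; rewrite expn_gt0 m0. Qed.

Lemma archimedean_inv x : Rlt 0 x -> exists G : nat, Rle 1 (Rmult (INR G) x).
Proof.
move=> x0; have [G hG] := INR_unbounded (/ x); exists G.
apply: Rlt_le; have -> : 1%real = (/ x * x)%real by field; lra.
exact: Rmult_lt_compat_r.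
Qed.

Lemma codeg_of k ba alpha (V : finType) (E : {set {set V}}) : 0 < k ->
  Rle 1 (Rmult (INR ba) alpha) -> uniform k E ->
  min_codeg_ge k E (Rmult alpha (INR #|V|)) -> codegE k ba E.
Proof.
move=> k0 hba hU hc S uS sS.
have cS : #|[set x in S]| = k.-1 by rewrite cardsE; move/card_uniqP: uS => ->.
have le1 : #|[set e in E | [set x in S] \subset e]| <= #|[set z | edge E (z :: S)]|.
  apply: leq_trans (leq_imset_card (fun z => [set x in z :: S]) _).
  apply/subset_leq_card/subsetP => e; rewrite inE => /andP[eE Se].
  have : #|e :\: [set x in S]| == 1.
    rewrite cardsD (setIidPr Se) cS (hU _ eE); apply/eqP; case: (k) k0 => // k' _ /=.
    by rewrite subSnn.
  case/cards1P => z hz.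
  have ez : e = [set x in z :: S].
    by rewrite -(setID e [set x in S]) (setIidPr Se) hz; apply/setP => x; rewrite !inE orbC.
  by apply/imsetP; exists z => //; rewrite inE /edge -ez.
apply: leq_INR; rewrite mult_INR; have h1 := hc _ cS; have h2 := INR_leq le1.
have b0 := pos_INR ba; have n0 := pos_INR #|V|.
apply: (Rle_trans _ (INR ba * (alpha * INR #|V|))); last first.
  by apply: Rmult_le_compat_l => //; lra.
rewrite -Rmult_assoc; have := Rmult_le_compat_r _ _ _ n0 hba; lra.
Qed.

Lemma dense_of k p cc : 0 < k -> Rlt 0 p -> exists (g : nat) (mu : R), Rlt 0 mu /\
  forall mu' (V : finType) (E : {set {set V}}), Rle mu' mu ->
    unif_dense k E p mu' -> denseE k cc g E.
Proof.
move=> k0 p0; set c := cc.+1.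
have c0 : Rlt 0 (INR (c ^ k)) by apply: INR_expn_pos.
(* The product of the |X_i| is at least n^k / c^k, so with [mu] half of p / c^k at least mu * n^k
   tuples survive the error term. The successor in [c] avoids division by 0. *)
pose mu := (p / 2 / INR (c ^ k))%real.
have mu0 : Rlt 0 mu by apply: Rdiv_lt_0_compat => //; lra.
have [G hG] := archimedean_inv mu0.
exists (2 ^ k * G), mu; split => // mu' V E hmu hE Z Z' hZ hZ'.
apply: Sum_Many; apply: leq_INR; rewrite mult_INR.
set S := Sum _ _.
pose X (i : 'I_k) := if val i == 0 then Z' else Z.
set N := #|V| ^ k.
have hX : N <= c ^ k * \prod_(i < k) #|X i|.
  have -> : c ^ k = \prod_(i < k) c by rewrite prod_nat_const card_ord.
  have -> : N = \prod_(i < k) #|V| by rewrite prod_nat_const card_ord.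
  rewrite -big_split /=; apply: leq_prod => i _; rewrite /X mulSn.
  by case: ifP => _; apply: leq_trans (leq_addl _ _).
have hS : #|[set x : {ffun 'I_k -> V} |
            [forall i, x i \in X i] && ([set x i | i : 'I_k] \in E)]| <= S.
  rewrite /S Sum_ffun -sum1_card big_mkcond; apply: leq_sum => x _; rewrite inE.
  case: ifP => // /andP[/forallP hx xE].
  suff -> : edge E [seq x i | i <- enum 'I_k] && head_in Z' Z [seq x i | i <- enum 'I_k] by [].
  apply/andP; split.
    rewrite /edge; suff -> : [set y in [seq x i | i <- enum 'I_k]] = [set x i | i : 'I_k] by [].
    apply/setP => y; rewrite inE; apply/mapP/imsetP => [] [i _ ->]; exists i => //.
    by rewrite mem_enum.
  move: hx; rewrite /X {hX X S hE}; case: k k0 c0 mu hG mu0 hmu N x xE => // k' _ _ _ _ _ _ _ x _ hx.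
  rewrite enum_ordSl /=; rewrite (hx ord0) /=; apply/allP => y /mapP[j].
  by case/mapP => i _ -> ->; apply: (hx (lift ord0 i)).
have h1 := hE X; have h2 := INR_leq hS; have h3 := INR_leq hX; have N0 := pos_INR N.
rewrite -/N in h1; rewrite mult_INR in h3.
move: h1 h2 h3; set P := INR (\prod_(i < k) _); set Q := INR #|_|; set T := INR S => h1 h2 h3.
have h4 : (2 * mu * INR N <= p * P)%real.
  have -> : (2 * mu * INR N = p / INR (c ^ k) * INR N)%real by rewrite /mu; field; lra.
  have -> : (p * P = p / INR (c ^ k) * (INR (c ^ k) * P))%real by field; lra.
  apply: Rmult_le_compat_l => //; apply: Rlt_le; exact: Rdiv_lt_0_compat.
have h5 : (mu' * INR N <= mu * INR N)%real by apply: Rmult_le_compat_r.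
have h6 : (mu * INR N <= T)%real by lra.
have G0 := pos_INR G; have := Rmult_le_compat_l _ _ _ G0 h6.
by have := Rmult_le_compat_r _ _ _ N0 hG; lra.
Qed.

Lemma FACTOR_of_gcdS k (VF : finType) (EF : {set {set VF}}) : 1 < k ->
  kpartite k EF -> gcdS k EF = 1 -> FACTOR k EF.
Proof.
move=> k1 hk hg p alpha p0 _ a0 _; have k0 := ltnW k1.
have [->|EF0] := eqVneq EF set0.
  exists 0, 1%real; split; first lra.
  move=> V E _ _ _ _; exact: empty_factor.
have [ba hba] := archimedean_inv a0.
have [cz H] := factor_dense ba k1 EF0 hk hg.
have [g [mu1 [m1 h1]]] := dense_of cz k0 p0.
have [c2 {}H] := H g.
have [g2 [mu2 [m2 h2]]] := dense_of c2 k0 p0.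
have [n0 {}H] := H g2.
exists n0, (Rmin mu1 mu2); split; first exact: Rmin_glb_lt.
move=> V E hU hD hC hn dv; apply: H => //.
- exact: codeg_of hC.
- by apply: h1 hD; apply: Rmin_l.
- by apply: h2 hD; apply: Rmin_r.
Qed.

(** * Random subsets and a tail bound *)

Lemma uniq_flatten (X Y : eqType) (f : X -> seq Y) r : uniq r ->
  (forall x, x \in r -> uniq (f x)) ->
  (forall x y z, x \in r -> y \in r -> z \in f x -> z \in f y -> x = y) ->
  uniq (flatten (map f r)).
Proof.
elim: r => [//|x r IH] /= /andP[xr ur] hu hd; rewrite cat_uniq hu ?mem_head //=.
apply/andP; split; last first.
  apply: IH => // [y yr|y z t yr zr]; first by rewrite hu // inE yr orbT.
  by apply: hd; rewrite inE ?yr ?zr orbT.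
apply/hasPn => z /flattenP[_ /mapP[y yr ->] zy]; apply: contra xr => zx.
by rewrite (hd x y z) ?mem_head // inE yr orbT.
Qed.

Section RandomSet.
Variable T : finType.
Implicit Types (F : {set T}) (L : seq (T * bool)) (J : seq (seq (T * bool))).

(** A uniformly random subset is modelled by summing over all [F]; this involution expresses that
    the membership of [b] is a fair bit independent of the others. *)
Definition flip (b : T) F := if b \in F then F :\ b else b |: F.

Lemma in_flip b c F : (c \in flip b F) = (c == b) (+) (c \in F).
Proof.
rewrite /flip; case: ifP => bF; rewrite !inE; case: (eqVneq c b) => //= ->.
  by rewrite bF.
by rewrite bF.
Qed.

Lemma flipK b : involutive (flip b).
Proof. by move=> F; apply/setP => c; rewrite !in_flip addbA addbb. Qed.

Definition holds L F := all (fun p => (p.1 \in F) == p.2) L.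

Lemma holds_flip b L F : b \notin map fst L -> holds L (flip b F) = holds L F.
Proof.
move=> h; apply: eq_in_all => p pL; rewrite in_flip.
by have [e|//] := eqVneq p.1 b; move: h; rewrite -e map_f.
Qed.

Lemma Sum_holds_bit b beta (psi : {set T} -> nat) : (forall F, psi (flip b F) = psi F) ->
  2 * \sum_(F : {set T}) ((b \in F) == beta) * psi F = \sum_F psi F.
Proof.
move=> h; rewrite mul2n -addnn {2}(reindex_inj (inv_inj (flipK b))) -big_split /=.
apply: eq_bigr => F _; rewrite h in_flip eqxx; case: (b \in F); case: beta => /=; lia.
Qed.

(** Independence: prescribed values of distinct bits have probability 2^-|L|, also relative to a
    [psi] that ignores these bits. *)
Lemma Sum_holds L (psi : {set T} -> nat) : uniq (map fst L) ->
  (forall b F, b \in map fst L -> psi (flip b F) = psi F) ->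
  2 ^ size L * \sum_F holds L F * psi F = \sum_F psi F.
Proof.
elim: L psi => [|[b beta] L IH] psi /=.
  by move=> _ _; rewrite mul1n; apply: eq_bigr => F _; rewrite mul1n.
move=> /andP[bL uL] h; rewrite -[RHS]IH //; last first.
  by move=> c F cL; apply: h; rewrite inE cL orbT.
rewrite expnS (mulnC 2) -mulnA; congr (_ * _).
rewrite -(Sum_holds_bit (b := b) beta (psi := fun F => holds L F * psi F)); last first.
  by move=> F; rewrite holds_flip // h // mem_head.
congr (_ * _); apply: eq_bigr => F _.
by rewrite mulnA; case: (_ == beta); rewrite /= ?mul1n.
Qed.

Definition bits J := flatten (map (map fst) J).

(** The exponential moment of the number of failures: the constraints use disjoint bits, and each
    contributes the factor 2 - 2^-k. *)
Lemma Sum_2_failures k J : all (fun L => size L == k) J -> uniq (bits J) ->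
  (2 ^ k) ^ size J * \sum_F 2 ^ count (fun L => ~~ holds L F) J
  = (2 * 2 ^ k - 1) ^ size J * #|{set T}|.
Proof.
elim: J => [|L J IH] /=; first by rewrite !mul1n sum1_card.
move=> /andP[/eqP sL hJ] uJ.
have [uL uLJ uJ'] : [/\ uniq (map fst L), ~~ has (mem (map fst L)) (bits J) & uniq (bits J)].
  by apply/and3P; rewrite -cat_uniq.
pose w F := 2 ^ count (fun L => ~~ holds L F) J.
have inv b F : b \in map fst L -> w (flip b F) = w F.
  move=> bL; rewrite /w; congr (2 ^ _); apply: eq_in_count => L' L'J; rewrite holds_flip //.
  apply: contra uLJ => bL'; apply/hasP; exists b => //.
  by apply/flattenP; exists (map fst L') => //; apply: map_f.
have := Sum_holds uL inv; rewrite sL => h.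
have : \sum_F 2 ^ (~~ holds L F + count (fun L => ~~ holds L F) J) + \sum_F holds L F * w F = 2 * \sum_F w F.
  rewrite -big_split big_distrr; apply: eq_bigr => F _ /=; rewrite expnD /w.
  by case: (holds L F) => /=; lia.
have : (2 ^ k) ^ size J * \sum_F w F = (2 * 2 ^ k - 1) ^ size J * #|{set T}| by exact: IH.
move: h; rewrite !expnS; set s1 := \sum_F _ * w F; set s2 := \sum_F w F; set s3 := \sum_F _.
move: (2 ^ k) => K h1 h2 h3.
have K1 : K * s3 = (2 * K - 1) * s2.
  have : K * s3 + s2 = 2 * K * s2 by rewrite -{1}h1 -mulnDr h3 mulnCA mulnA.
  by rewrite mulnBl mul1n => <-; rewrite addnK.
by rewrite mulnAC K1 -[RHS]mulnA -h2 -mulnA (mulnC s2).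
Qed.

(** Markov's inequality with K = 2^k and r = |J|: at most q successes mean at least r - q failures,
    hence weight at least 2^(r-q), while the mean weight is (2 - 1/K)^r <= 2^r / 2^(2q) because r >=
    2K * 2q. *)
Lemma few_bad k q J : all (fun L => size L == k) J -> uniq (bits J) ->
  4 * 2 ^ k * q <= size J ->
  #|[set F | count (fun L => holds L F) J <= q]| * 2 ^ q <= #|{set T}|.
Proof.
move=> hJ uJ hq; set Bd := [set F | _]; set r := size J; set K := 2 ^ k.
have K0 : 0 < K by rewrite expn_gt0.
have h1 : #|Bd| * 2 ^ (r - q) <= \sum_F 2 ^ count (fun L => ~~ holds L F) J.
  rewrite -sum_nat_const [X in _ <= X](bigID (mem Bd)) /=; apply: leq_trans (leq_addr _ _).
  apply: leq_sum => F; rewrite inE => cq; rewrite leq_exp2l //.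
  have := count_predC (fun L => holds L F) J; rewrite -/r.
  by rewrite (eq_count (a1 := predC (fun L => holds L F)) (a2 := fun L => ~~ holds L F)) //; lia.
have h2 := Sum_2_failures hJ uJ; rewrite -/r -/K in h2.
have [e1 e2] : (2 * K - 1).+1 = 2 * K /\ 0 < 2 * K - 1 by move: (K) K0; clear; lia.
have qr : q <= r by apply: leq_trans hq; rewrite leq_pmull // muln_gt0 K0.
have h3 : 2 ^ (2 * q) * (2 * K - 1) ^ r <= (2 * K) ^ r.
  have e4 : 4 * K * q = 2 * K * (2 * q) by move: (K) (q); clear; lia.
  have -> : r = 2 * K * (2 * q) + (r - 4 * K * q) by rewrite -e4 subnKC.
  rewrite !(expnD _ (2 * K * _)) mulnA; apply: leq_mul; last by apply: leq_expn2r; rewrite -{2}e1.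
  rewrite !(expnM _ (2 * K)). rewrite -expnMn; apply: leq_expn2r.
  by have := bernoulli2 e2; rewrite e1.
have h4 : (2 ^ r * K ^ r) * (#|Bd| * 2 ^ q) <= (2 ^ r * K ^ r) * #|{set T}|.
  apply: (@leq_trans (2 ^ (2 * q) * (K ^ r * (#|Bd| * 2 ^ (r - q))))).
    have -> : 2 ^ r = 2 ^ (r - q) * 2 ^ q by rewrite -expnD subnK.
    by rewrite mul2n -addnn expnD; apply: eq_leq; move: (2 ^ _) (2 ^ _) (K ^ r) #|Bd|; clear; nia.
  apply: (@leq_trans (2 ^ (2 * q) * ((2 * K - 1) ^ r * #|{set T}|))).
    by rewrite leq_mul2l -h2 leq_mul2l h1 !orbT.
  by rewrite mulnA -expnMn leq_mul2r h3 orbT.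
by move: h4; rewrite leq_pmul2l // muln_gt0 !expn_gt0.
Qed.

End RandomSet.

Lemma ffact_lower n k : n ^ k <= n ^_ k + k ^ 2 * n ^ k.-1.
Proof.
elim: k => [|k IH] /=; first by rewrite ffactn0.
rewrite ffactnSr.
have [nk|kn] := leqP n k.
  apply: leq_trans (leq_addl _ _); rewrite expnS leq_mul2r; apply/orP; right; nia.
case: k IH kn => [|k] IH kn; first by rewrite ffactn0 expn1; lia.
move: IH => /=; have n0 : 0 < n by lia.
rewrite !expnS; move: (n ^_ k.+1) (n ^ k) => f p IH; nia.
Qed.

(** * The random construction for necessity *)

Section Construction.
Variables (k n : nat) (s : 'I_n -> bool).
Hypothesis k3 : 3 <= k.
Notation V := 'I_n.
Implicit Types (F : {set {set 'I_n}}) (S e : {set 'I_n}).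

(** [s] is the partition into two sides, and [F] encodes the random choice: a (k-1)-set in [F]
    allows side [true], one outside [F] allows side [false]. *)
Definition side_edges F := [set e : {set V} | (#|e| == k) && [forall x in e, ((e :\ x) \in F) == s x]].

Lemma side_edges_side F S x y : x \notin S -> y \notin S -> x |: S \in side_edges F -> y |: S \in side_edges F -> s x = s y.
Proof.
move=> xS yS; rewrite !inE => /andP[_ /forall_inP/(_ x)] hx /andP[_ /forall_inP/(_ y)] hy.
have := hx (setU11 _ _); have := hy (setU11 _ _).
by rewrite !setU1K // => /eqP <- /eqP <-.
Qed.

Definition edge_bits e : seq ({set V} * bool) := [seq (e :\ x, s x) | x <- enum e].

Lemma side_edges_holds F e : #|e| = k -> (e \in side_edges F) = holds (edge_bits e) F.
Proof.
move=> ce; rewrite inE ce eqxx /holds all_map; apply/forall_inP/allP => h x xe.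
  by apply: h; rewrite mem_enum in xe.
by apply: h; rewrite mem_enum.
Qed.

(* Distinct k-sets with the same sum mod n share at most k-2 vertices, so the random
   bits that decide them are disjoint. *)
Definition sum_mod e := (\sum_(x in e) (x : nat)) %% n.

(** If two such k-sets share a (k-1)-set, the remaining vertices are congruent mod n and below n,
    hence equal. *)
Lemma uniq_bits_sum_mod (A : {set {set V}}) c : (forall e, e \in A -> sum_mod e = c) ->
  uniq (bits [seq edge_bits e | e <- enum A]).
Proof.
move=> hA; rewrite /bits -map_comp; apply: uniq_flatten; first exact: enum_uniq.
  move=> e _ /=; rewrite -map_comp map_inj_in_uniq ?enum_uniq // => x y.
  rewrite !mem_enum /= => xe ye h; apply/eqP; apply: contraT => ne.
  by have := setD11 x e; rewrite h !inE xe ne.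
move=> e e' z; rewrite !mem_enum /= -!map_comp => eA e'A /mapP[x xe hx] /mapP[x' xe' hx'].
rewrite !mem_enum /= in xe xe' hx hx'.
have : sum_mod e = sum_mod e' by rewrite !hA.
rewrite /sum_mod (bigD1 x) // (bigD1 x' xe') /=.
have sm (g : {set V}) y : y \in g -> \sum_(i in g | i != y) (i : nat) = \sum_(i in g :\ y) (i : nat).
  by move=> yg; apply: eq_bigl => i; rewrite !inE andbC.
rewrite !sm // -hx -hx' => /eqP; rewrite eqn_modDr !modn_small ?ltn_ord // => /eqP/val_inj xx.
by rewrite -(setD1K xe) -(setD1K xe') -hx -hx' xx.
Qed.

End Construction.

Lemma bin_le_expn n m : 'C(n, m) <= n ^ m.
Proof.
apply: (@leq_trans (n ^_ m)); first by rewrite -bin_ffact leq_pmulr // fact_gt0.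
elim: m => [|m IH]; first by rewrite ffactn0.
by rewrite ffactnSr expnSr leq_mul // leq_subr.
Qed.

Lemma card_set_type (T : finType) : #|{set T}| = 2 ^ #|T|.
Proof. by rewrite -(cardsT T) -card_powerset powersetT cardsT. Qed.

Lemma count_enum (T : finType) (A : {set T}) (P : pred T) :
  count P (enum A) = #|[set x in A | P x]|.
Proof.
rewrite -size_filter -(card_uniqP (filter_uniq _ (enum_uniq _))).
by apply: eq_card => x; rewrite mem_filter mem_enum inE andbC.
Qed.

Section Construction.
Variables (k n : nat) (s : 'I_n -> bool).
Hypothesis k3 : 3 <= k.
Notation V := 'I_n.
Implicit Types (F : {set {set 'I_n}}) (S e : {set 'I_n}) (X : {ffun 'I_k -> {set 'I_n}}).

Definition spanned X := [set e : {set V} | (#|e| == k) &&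
  [exists x : {ffun 'I_k -> V}, [forall i, x i \in X i] && ([set x i | i : 'I_k] == e)]].

Definition spanned_mod X (c : 'I_n) := [set e in spanned X | sum_mod e == c].

Definition ncopies (E : {set {set 'I_n}}) X := #|[set x : {ffun 'I_k -> V} |
   [forall i, x i \in X i] && ([set x i | i : 'I_k] \in E)]|.

Lemma sum_spanned_mod (P : pred {set V}) X : 0 < n ->
  \sum_c #|[set e in spanned_mod X c | P e]| = #|[set e in spanned X | P e]|.
Proof.
move=> n0; rewrite -[RHS]sum1_card.
have h e : sum_mod e < n by rewrite /sum_mod ltn_mod.
rewrite (partition_big (fun e => Ordinal (h e)) xpredT) //=.
apply: eq_bigr => c _; rewrite sum1_card; apply: eq_card => e.
have hc : (Ordinal (h e) == c) = (sum_mod e == c) by [].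
rewrite /spanned_mod [LHS]inE [e \in [set e in spanned X | sum_mod e == c]]inE andbAC.
by rewrite -hc -[in LHS](in_set (fun e => (e \in spanned X) && P e)).
Qed.

Lemma count_edges F X : 0 < n ->
  \sum_c count (fun L => holds L F) [seq edge_bits s e | e <- enum (spanned_mod X c)] <= ncopies (side_edges k s F) X.
Proof.
move=> n0; rewrite (eq_bigr (fun c => #|[set e in spanned_mod X c | e \in side_edges k s F]|)).
  rewrite sum_spanned_mod //; apply: leq_trans (leq_imset_card (fun x : {ffun 'I_k -> V} => [set x i | i : 'I_k]) _).
  apply/subset_leq_card/subsetP => e; rewrite !inE -!andbA => /and4P[_ /existsP[x /andP[hx /eqP xe]] c1 c2].
  by apply/imsetP; exists x => //; rewrite inE hx xe inE c1 c2.
move=> c _; rewrite count_map count_enum; apply: eq_card => e.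
rewrite !inE; case ce: (#|e| == k) => //=.
by rewrite -(side_edges_holds _ F (eqP ce)) !inE ce.
Qed.

(** A k-set is the image of at most k^k tuples; the second term bounds the non-injective tuples, by
    [ffact_lower]. *)
Lemma prod_le_spanned X : \prod_(i < k) #|X i| <= k ^ k * #|spanned X| + k ^ 2 * n ^ k.-1.
Proof.
pose A := [set x : {ffun 'I_k -> V} | [forall i, x i \in X i]].
pose I := [set x : {ffun 'I_k -> V} | injectiveb x].
have -> : \prod_(i < k) #|X i| = #|A|.
  rewrite -[RHS]sum1_card (eq_bigr (fun i => \sum_(v | v \in X i) 1)); last first.
    by move=> i _; rewrite sum1_card.
  rewrite bigA_distr_big_dep; apply: eq_big => [x|x _]; last by rewrite big1.
  by rewrite [RHS]inE; apply/familyP/forallP.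
rewrite -(cardsID I A); apply: leq_add; last first.
  apply: (@leq_trans #|~: I|); first by apply: subset_leq_card; rewrite setDE subsetIr.
  have := cardsC I; rewrite card_inj_ffuns card_ffun !card_ord.
  have := ffact_lower n k; lia.
pose im (x : {ffun 'I_k -> V}) := [set x i | i : 'I_k].
rewrite -sum1_card (partition_big im (mem (spanned X))) /=; last first.
  move=> x; rewrite !inE => /andP[hx /injectiveP xi]; rewrite card_imset // card_ord eqxx /=.
  by apply/existsP; exists x; rewrite hx eqxx.
rewrite mulnC -sum_nat_const; apply: leq_sum => e eX.
have ce : #|e| = k by move: eX; rewrite inE => /andP[/eqP].
have := card_ffun_on 'I_k (mem e); rewrite card_ord [X in X ^ _]ce => <-; rewrite sum1_card.
apply: subset_leq_card; apply/subsetP => x; rewrite inE => /andP[_ /eqP <-].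
by apply/ffun_onP => i; apply: imset_f.
Qed.

(** The bit of [S] itself is shared by all edges through [S], so it is left out and its value [beta]
    is guessed; the remaining k-1 bits of different [x] are disjoint. *)
Definition codeg_bits S beta : seq (seq ({set V} * bool)) :=
  [seq [seq ((x |: S) :\ y, s y) | y <- enum S] |
     x <- enum [set x | (s x == beta) && (x \notin S)]].

Lemma uniq_codeg_bits S beta : uniq (bits (codeg_bits S beta)).
Proof.
rewrite /bits /codeg_bits -map_comp; apply: uniq_flatten; first exact: enum_uniq.
  move=> x; rewrite mem_enum inE => /andP[_ xS] /=; rewrite -map_comp map_inj_in_uniq ?enum_uniq //.
  move=> y z; rewrite !mem_enum /= => yS zS h; apply/eqP; apply: contraT => ne.
  by have := setD11 y (x |: S); rewrite h !inE yS orbT ne.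
move=> x y z; rewrite !mem_enum !inE /= -!map_comp => /andP[_ xS] /andP[_ yS].
case/mapP => x' x'S -> /mapP[y' y'S /= /setP/(_ x)]; rewrite !mem_enum in x'S y'S.
rewrite !inE eqxx (negPf xS) /= orbF andbT.
have -> : x != x' by apply: contraNneq xS => ->.
by move=> /esym/andP[_ /eqP].
Qed.

Lemma holds_codeg_bits F S beta : #|S| = k.-1 -> (S \in F) = beta ->
  count (fun L => holds L F) (codeg_bits S beta) <= #|[set e in side_edges k s F | S \subset e]|.
Proof.
move=> cS SF; rewrite count_map count_enum.
set A := [set x in _ | _].
have hA x : x \in A -> x \notin S by rewrite !inE => /andP[/andP[]].
have inj : {in A &, injective (fun x => x |: S)}.
  move=> x y /hA xS _ /setP/(_ x); rewrite setU11 in_setU1 (negPf xS) orbF.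
  by move=> /esym/eqP.
rewrite -(card_in_imset inj); apply: subset_leq_card; apply/subsetP => _ /imsetP[x xA ->].
move: xA (hA x xA); rewrite !inE => /andP[/andP[/eqP sx _] /= ex] xS.
rewrite subsetUr andbT cardsU1 xS cS add1n prednK ?eqxx /=; last by lia.
apply/forall_inP => y; rewrite !inE => /orP[/eqP ->|yS].
  by rewrite setU1K // SF sx.
by move: ex; rewrite /holds all_map => /allP/(_ y); rewrite mem_enum; apply.
Qed.

(** Union bound over two families, each of total probability at most 1/4: at most 2n^(k-1) pairs (S,
    beta) with failure probability at most 2^-q1, and at most 2^(nk+n) pairs (X, c) with at most
    2^-Q. Adding [Q] makes the second claim trivial for pairs whose quota is below [Q], where the
    tail bound is too weak. *)
Lemma good_exists q1 (Q := (k + 3) * n) : 0 < n ->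
  (forall beta, n + 4 * k <= 4 * #|[set x | s x == beta]|) ->
  2 ^ (k + 3) * q1 <= n -> 8 * n ^ k.-1 <= 2 ^ q1 ->
  exists F, (forall S, #|S| = k.-1 -> q1 < #|[set e in side_edges k s F | S \subset e]|) /\
    (forall X c, #|spanned_mod X c| %/ (4 * 2 ^ k) <=
       count (fun L => holds L F) [seq edge_bits s e | e <- enum (spanned_mod X c)] + Q).
Proof.
move=> n0 hs hq1 hq.
set Om := #|{set {set V}}|.
have Om0 : 0 < Om by rewrite /Om card_set_type expn_gt0.
pose B1 (p : {set V} * bool) := [set F : {set {set V}} | count (fun L => holds L F) (codeg_bits p.1 p.2) <= q1].
pose q X c := #|spanned_mod X c| %/ (4 * 2 ^ k).
pose B2 (p : {ffun 'I_k -> {set V}} * V) :=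
  [set F : {set {set V}} | count (fun L => holds L F) [seq edge_bits s e | e <- enum (spanned_mod p.1 p.2)] <= q p.1 p.2].
pose D1 := [set p : {set V} * bool | #|p.1| == k.-1].
pose D2 := [set p : {ffun 'I_k -> {set V}} * V | Q <= q p.1 p.2].
have b1 p : p \in D1 -> #|B1 p| * 2 ^ q1 <= Om.
  case: p => S beta; rewrite inE /= => /eqP cS; apply: (@few_bad _ k.-1).
  - by rewrite all_map; apply/allP => x _ /=; rewrite size_map -cardE cS.
  - exact: uniq_codeg_bits.
  rewrite size_map -cardE.
  (* Side [beta] keeps at least n/4 vertices outside [S], and 2^(k+3) is 4 times the factor 4 *
     2^(k-1) that [few_bad] asks for with k-1 bits. *)
  have h1 := hs beta; have h2 := cardsID S [set x | s x == beta].
  have h3 := subset_leq_card (subsetIr [set x | s x == beta] S); rewrite cS in h3.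
  have e1 : [set x | s x == beta] :\: S = [set x | (s x == beta) && (x \notin S)].
    by apply/setP => x; rewrite !inE andbC.
  rewrite e1 in h2.
  have e2 : 2 ^ (k + 3) = 16 * 2 ^ k.-1.
    by rewrite -{1}(prednK (ltnW (ltnW k3))) addSnnS expnD mulnC.
  move: hq1; rewrite e2; set a := #|pred_of_set [set x | s x == beta]| in h1 h2.
  set b := #|_ :&: _| in h2 h3; move: h1 h2 h3; set d := #|_|.
  move: (2 ^ k.-1) a b d => K a b d; clear; lia.
have b2 p : p \in D2 -> #|B2 p| * 2 ^ Q <= Om.
  case: p => X c; rewrite inE /= => hQ.
  apply: (@leq_trans (#|B2 (X, c)| * 2 ^ q X c)); first by rewrite leq_mul2l leq_exp2l // hQ orbT.
  apply: (@few_bad _ k).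
  - rewrite all_map; apply/allP => e; rewrite mem_enum !inE => /andP[/andP[ce _] _] /=.
    by rewrite size_map -cardE.
  - by apply: (@uniq_bits_sum_mod _ _ _ c) => e; rewrite inE => /andP[_ /eqP].
  - by rewrite size_map -cardE mulnC leq_trunc_div.
have s1 : 4 * \sum_(p in D1) #|B1 p| <= Om.
  have h : 2 ^ q1 * \sum_(p in D1) #|B1 p| <= (2 * n ^ k.-1) * Om.
    rewrite big_distrr /=; apply: (@leq_trans (\sum_(p in D1) Om)).
      by apply: leq_sum => p pD; rewrite mulnC b1.
    rewrite sum_nat_const leq_mul2r; apply/orP; right.
    have -> : D1 = setX [set S : {set V} | #|S| == k.-1] [set: bool].
      by apply/setP => [[S beta]]; rewrite !inE andbT.
    by rewrite cardsX card_draws cardsT card_bool card_ord mulnC leq_mul2l bin_le_expn orbT.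
  have np : 0 < n ^ k.-1 by rewrite expn_gt0 n0.
  have : 8 * n ^ k.-1 * \sum_(p in D1) #|B1 p| <= 2 * n ^ k.-1 * Om.
    by apply: leq_trans h; rewrite leq_mul2r hq orbT.
  have -> : 8 * n ^ k.-1 * \sum_(p in D1) #|B1 p| = 2 * n ^ k.-1 * (4 * \sum_(p in D1) #|B1 p|).
    by rewrite mulnA; congr (_ * _); rewrite mulnAC.
  by rewrite leq_pmul2l // muln_gt0 np.
have s2 : 4 * \sum_(p in D2) #|B2 p| <= Om.
  have h : 2 ^ Q * \sum_(p in D2) #|B2 p| <= 2 ^ (n * k + n) * Om.
    rewrite big_distrr /=; apply: (@leq_trans (\sum_(p in D2) Om)).
      by apply: leq_sum => p pD; rewrite mulnC b2.
    rewrite sum_nat_const leq_mul2r; apply/orP; right.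
    apply: leq_trans (max_card _) _; rewrite card_prod card_ffun card_set_type !card_ord.
    by rewrite -expnM expnD leq_mul2l ltnW ?orbT // ltn_expl.
  have h2 : 2 ^ (n * k + n) * 4 <= 2 ^ Q.
    rewrite -(expnD 2 _ 2) leq_exp2l // /Q; move: n0; clear; nia.
  have : 2 ^ (n * k + n) * (4 * \sum_(p in D2) #|B2 p|) <= 2 ^ (n * k + n) * Om.
    by apply: leq_trans h; rewrite mulnA leq_mul2r h2 orbT.
  by rewrite leq_pmul2l // expn_gt0.
have [F hF] : exists F, [forall p in D1, F \notin B1 p] && [forall p in D2, F \notin B2 p].
  apply/existsP; apply: contraT; rewrite negb_exists => /forallP hbad.
  have : Om <= \sum_(p in D1) #|B1 p| + \sum_(p in D2) #|B2 p|.
    rewrite /Om -sum1_card.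
    have cB (B : {set {set {set V}}}) : #|B| = \sum_F (F \in B).
      by rewrite -sum1_card big_mkcond; apply: eq_bigr => F _; case: (F \in B).
    under [X in _ <= X + _]eq_bigr do rewrite cB.
    under [X in _ <= _ + X]eq_bigr do rewrite cB.
    rewrite exchange_big [X in _ <= _ + X]exchange_big -big_split /=.
    apply: leq_sum => F _; have := hbad F; rewrite negb_and => /orP[]; rewrite negb_forall;
      case/existsP => p; rewrite negb_imply negbK => /andP[pD pB].
      by rewrite (bigD1 p) //= pB.
    by rewrite [X in _ + X](bigD1 p) //= pB addnCA.
  by move: Om0 s1 s2; clear; lia.
exists F; case/andP: hF => /forall_inP h1 /forall_inP h2; split.
  move=> S cS; apply: leq_trans (holds_codeg_bits (F := F) cS erefl).
  by have := h1 (S, S \in F); rewrite !inE cS eqxx -ltnNge; apply.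
move=> X c; rewrite -/(q X c).
have [hQ|/ltnW hQ] := leqP Q (q X c); last by apply: leq_trans hQ (leq_addl _ _).
have := h2 (X, c); rewrite !inE /= -ltnNge => /(_ hQ)/ltnW h.
exact: leq_trans h (leq_addr _ _).
Qed.

(** Each of the n residues loses O(n), in all O(n^2). For k >= 3 this is O(n^(k-1)), hence
    negligible against n^k. *)
Lemma side_edges_dense F X : 0 < n -> (forall c, #|spanned_mod X c| %/ (4 * 2 ^ k) <=
       count (fun L => holds L F) [seq edge_bits s e | e <- enum (spanned_mod X c)] + (k + 3) * n) ->
  \prod_(i < k) #|X i| <= 4 * 2 ^ k * k ^ k * ncopies (side_edges k s F) X
     + (4 * 2 ^ k * k ^ k * (k + 4) + k ^ 2) * n ^ k.-1.
Proof.
move=> n0 h; apply: leq_trans (prod_le_spanned X) _.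
have hn : n * n <= n ^ k.-1.
  by rewrite (_ : n * n = n ^ 2) // leq_pexp2l //; lia.
have hI : #|spanned X| <= 4 * 2 ^ k * (ncopies (side_edges k s F) X + (k + 4) * n ^ k.-1).
  have := sum_spanned_mod xpredT X n0; rewrite (_ : [set e in spanned X | true] = spanned X); last first.
    by apply/setP => e; rewrite inE andbT.
  move=> <-; apply: (@leq_trans (4 * 2 ^ k * (\sum_c
      (count (fun L => holds L F) [seq edge_bits s e | e <- enum (spanned_mod X c)] + ((k + 3) * n).+1)))).
    rewrite big_distrr; apply: leq_sum => c _.
    rewrite (_ : [set e in spanned_mod X c | true] = spanned_mod X c); last by apply/setP => e; rewrite inE andbT.
    have K0 : 0 < 4 * 2 ^ k by rewrite muln_gt0 expn_gt0.
    apply: ltnW; apply: leq_trans (ltn_ceil #|spanned_mod X c| K0) _.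
    by rewrite mulnC leq_mul2l addnS ltnS h orbT.
  rewrite leq_mul2l; apply/orP; right; rewrite big_split; apply: leq_add; first exact: count_edges.
  rewrite sum_nat_const card_ord; apply: (@leq_trans ((k + 4) * (n * n))); last by rewrite leq_mul2l hn orbT.
  by move: n0; clear; nia.
rewrite mulnDl addnA leq_add2r.
apply: (@leq_trans (k ^ k * (4 * 2 ^ k * (ncopies (side_edges k s F) X + (k + 4) * n ^ k.-1)))).
  by rewrite leq_mul2l hI orbT.
by apply: eq_leq; move: (k ^ k) (2 ^ k) (n ^ k.-1) (ncopies _ _); clear; lia.
Qed.

End Construction.

(** * Complete k-partite k-graphs *)

Section CompletePartite.
Variables (k : nat) (a : 'I_k -> nat).
Hypothesis ha : forall i, 0 < a i.

Lemma realisation_tag : realisation (Kedges a) [ffun x => tag x].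
Proof.
apply/forall_inP => e; rewrite inE => /forallP he; apply/forallP => i.
rewrite (_ : [set x in e | [ffun x => tag x] x == i] = [set x in e | tag x == i]) //.
by apply/setP => x; rewrite !inE ffunE.
Qed.

Lemma card_tag i : #|[set x : Kvert a | tag x == i]| = a i.
Proof.
rewrite -sum1_card; under eq_bigl do rewrite inE.
rewrite (eq_bigl (fun x : Kvert a => (tag x == i) && true)); last by move=> x; rewrite andbT.
rewrite -(sig_big_dep (fun i' => i' == i) (fun _ _ => true) (fun _ _ => 1)) big_pred1_eq.
by rewrite sum1_card card_ord.
Qed.

Lemma gcdS_dvd i : gcdS k (Kedges a) %| a i.
Proof.
have hi : a i < #|Kvert a|.+1 by rewrite ltnS -(card_tag i) max_card.
apply: (biggcdn_inf (Ordinal hi)) => //.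
apply/existsP; exists [ffun x => tag x]; rewrite realisation_tag /=.
apply/existsP; exists i; apply/eqP; rewrite /= -[RHS]card_tag; apply: eq_card => x.
by rewrite !inE ffunE.
Qed.

Definition base i : Kvert a := Tagged (fun i => 'I_(a i)) (Ordinal (ha i)).

Definition transversal (x : Kvert a) := x |: [set base j | j in predC1 (tag x)].

Lemma base_notin x : x \notin [set base j | j in predC1 (tag x)].
Proof. by apply/imsetP => [[j jx xj]]; move: jx; rewrite inE xj eqxx. Qed.

Lemma transversal_edge x : transversal x \in Kedges a.
Proof.
rewrite inE; apply/forallP => j.
rewrite (_ : [set z in _ | _] = [set (if j == tag x then x else base j)]) ?cards1 //.
apply/setP => z; rewrite !inE; apply/andP/eqP => [[/orP[/eqP ->|/imsetP[i ix ->]] /eqP <-]|->].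
- by rewrite eqxx.
- by move: ix; rewrite inE /= => /negPf ->.
have [-> |jx] := eqVneq j (tag x); first by split; rewrite ?eqxx.
split => //; apply/orP; right; apply/imsetP; exists j => //.
Qed.

(** Completeness puts both vertices into edges with the same base vertices of the other classes, and
    the image of that (k-1)-set allows one side only. *)
Lemma copy_side n (s : 'I_n -> bool) F phi : is_copy (Kedges a) (side_edges k s F) phi ->
  forall x y, tag x = tag y -> s (phi x) = s (phi y).
Proof.
move=> [inj hphi] x y xy.
have H z : phi @: transversal z = phi z |: phi @: [set base j | j in predC1 (tag z)].
  by rewrite /transversal imsetU1.
have N z : phi z \notin phi @: [set base j | j in predC1 (tag z)].
  by rewrite mem_imset // base_notin.
apply: (side_edges_side (N x) (F := F) (k := k)).
- by rewrite xy N.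
- by rewrite -H; apply: hphi; apply: transversal_edge.
- by rewrite xy -H; apply: hphi; apply: transversal_edge.
Qed.

Lemma factor_side n (s : 'I_n -> bool) F d : (forall i, d %| a i) ->
  has_factor (Kedges a) (side_edges k s F) -> d %| #|[set x | s x]|.
Proof.
move=> hd [m [phi [hc [hi hs]]]].
pose f (p : 'I_m * Kvert a) := phi p.1 p.2.
have fi : injective f.
  move=> [j x] [j' x'] /= h; have /= e := hi _ _ _ _ h; move: h; rewrite /f /= -e.
  by have [inj _] := hc j => /inj ->.
have fs v : exists p, f p == v by have [j [x e]] := hs v; exists (j, x); rewrite /f /= e.
have fb : bijective f.
  exists (fun v => xchoose (fs v)) => [p|v]; last exact/eqP/(xchooseP (fs v)).
  by apply: fi; apply/eqP/(xchooseP (fs (f p))).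
have -> : #|[set x | s x]| = \sum_v s v.
  by rewrite -sum1_card big_mkcond; apply: eq_bigr => v _; rewrite inE; case: (s v).
rewrite (reindex f) /=; last exact: onW_bij.
rewrite -(pair_big xpredT xpredT (fun j x => (s (phi j x) : nat))) /=.
apply: dvdn_sum => j _.
have E := @sig_big_dep _ _ addn _ (fun i => 'I_(a i)) xpredT (fun _ => xpredT)
   (fun i y => (s (phi j (Tagged (fun i => 'I_(a i)) y)) : nat)).
rewrite (eq_bigr (fun p : Kvert a => (s (phi j (Tagged (fun i => 'I_(a i)) (tagged p))) : nat))).
  rewrite -E; apply: dvdn_sum => i _.
  rewrite (eq_bigr (fun=> (s (phi j (base i)) : nat))); last first.
    by move=> y _; rewrite (copy_side (hc j) (y := base i)).
  by rewrite sum_nat_const card_ord dvdn_mulr.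
by move=> [i y].
Qed.

Lemma gcdS_of_FACTOR : 3 <= k -> FACTOR k (Kedges a) -> gcdS k (Kedges a) = 1.
Proof.
move=> k3 hF; set d := gcdS _ _.
have hd i : d %| a i := gcdS_dvd i.
have i0 : 'I_k by apply: (Ordinal (ltnW (ltnW k3))).
have d0 : 0 < d.
  by rewrite lt0n; apply: contraTneq (hd i0) => ->; rewrite dvd0n -lt0n.
apply/eqP; apply: contraT => d1.
(* 1/D and 1/K are the density and codegree proportions that the construction attains, by
   [side_edges_dense] and by [good_exists] with q1 = n %/ K. *)
set K := 2 ^ (k + 3); set D := 4 * 2 ^ k * k ^ k.
set C := D * (k + 4) + k ^ 2.
have K1 : 1 < K by rewrite /K addn3 -(expn0 2) ltn_exp2l.
have D1 : 1 < D.
  rewrite /D -mulnA; apply: leq_trans (leq_pmulr 4 _) => //.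
  by rewrite muln_gt0 !expn_gt0; case: (k) k3.
have rK : (1 < INR K)%real by apply: (lt_INR 1); apply/ltP.
have rD : (1 < INR D)%real by apply: (lt_INR 1); apply/ltP.
have inv x : (1 < x -> 0 < / x /\ / x < 1)%real.
  move=> x1; split; first by apply: Rinv_0_lt_compat; lra.
  by rewrite -Rinv_1; apply: Rinv_lt_contravar; lra.
have [D2 D3] := inv _ rD; have [K2 K3] := inv _ rK.
have [n0 [mu [mu0 {}hF]]] := hF _ _ D2 D3 K2 K3.
have [G hG] := archimedean_inv mu0.
have [n1 hn1] := @expn_poly k K (ltnW K1).
set m := #|Kvert a|; have m0 : 0 < m.
  by apply/card_gt0P; exists (base i0).
(* 8 absorbs the factor in 8n^(k-1) <= n^k, the terms in [d] and [k] keep both sides of size at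
   least n/4 + k, and [G * C] gives mu * n >= C, so the error C * n^(k-1) stays below mu * n^k. *)
set t := n0 + n1 + 8 + 4 * d + 4 * k + 4 + G * C.
set n := m * t; have tn : t <= n by rewrite leq_pmull.
have [nn0 nn1 n8 nd nG] : [/\ n0 <= n, n1 <= n, 8 <= n, 4 * d + 4 * k + 4 <= n & G * C <= n].
  by split; apply: leq_trans tn; rewrite /t; clear; lia.
have n_gt0 : 0 < n by apply: leq_trans n8.
(* One side gets about n/2 vertices, with a size congruent to 1 modulo [d]; a factor would make [d]
   divide it. *)
pose x := d * (n %/ (2 * d)); pose w := x + 1.
have wn : 2 * x <= n by rewrite /x mulnA mulnC leq_trunc_div.
have wn2 : n < 2 * x + 2 * d.
  by rewrite /x -mulnDr addnC -mulnS mulnA mulnC ltn_ceil // muln_gt0.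
pose s (i : 'I_n) := i < w.
have wle : w <= n by move: wn wn2 nd d0; rewrite /w; clear; lia.
have cs : #|[set i | s i]| = w.
  have inj : injective (widen_ord wle) by move=> i j /(congr1 val) h; apply: val_inj.
  rewrite -[RHS](card_ord w) -cardsT -(card_imset _ inj).
  apply: eq_card => i; rewrite !inE; apply/idP/imsetP => [iw|[j _ ->]]; last exact: (ltn_ord j).
  by exists (Ordinal iw) => //; apply: val_inj.
have hs beta : n + 4 * k <= 4 * #|[set i | s i == beta]|.
  have e1 : #|[set i | s i == true]| = w by rewrite -cs; apply: eq_card => i; rewrite !inE eqb_id.
  have e2 : #|[set i | s i == false]| = n - w.
    have := cardsC [set i | s i]; rewrite cs card_ord => e3; rewrite -[X in X - w]e3 addKn.
    by apply: eq_card => i; rewrite !inE; case: (s i).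
  by case: beta; rewrite ?e1 ?e2; move: wn wn2 nd d0; rewrite /w; clear; lia.
have hq : 8 * n ^ k.-1 <= 2 ^ (n %/ K).
  apply: leq_trans (hn1 _ nn1); rewrite -{2}(prednK (ltnW (ltnW k3))) expnS.
  by rewrite leq_mul2r n8 orbT.
have hq1 : K * (n %/ K) <= n by rewrite mulnC leq_trunc_div.
have [F [F1 F2]] := good_exists k3 n_gt0 hs hq1 hq.
have : has_factor (Kedges a) (side_edges k s F).
  apply: hF.
  - by move=> e; rewrite inE => /andP[/eqP].
  - move=> X; have := side_edges_dense (X := finfun X) k3 n_gt0 (F2 (finfun X)).
    rewrite -/D -/C card_ord (eq_bigr (fun i => #|X i|)); last by move=> i _; rewrite ffunE.
    set P := \prod_(i < k) _; have -> : ncopies (side_edges k s F) (finfun X) = #|[set x : {ffun 'I_k -> 'I_n} |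
       [forall i, x i \in X i] && ([set x i | i : 'I_k] \in side_edges k s F)]|.
      apply: eq_card => f; rewrite !inE; congr (_ && _).
      by apply: eq_forallb => i; rewrite ffunE.
    set c := #|_| => /INR_leq; rewrite plus_INR (mult_INR D) (mult_INR C) => hP.
    have hn : n ^ k = n * n ^ k.-1 by rewrite -expnS prednK // (ltnW (ltnW k3)).
    rewrite hn (mult_INR n); move: hP; move: (INR P) (INR c) (pos_INR c) => rP rc c0 hP.
    have hC : (INR C <= mu * INR n)%real.
      have h1 := INR_leq nG; rewrite mult_INR in h1.
      have h2 := Rmult_le_compat_r _ _ _ (pos_INR C) hG.
      have := Rmult_le_compat_l mu _ _ (Rlt_le _ _ mu0) h1; lra.
    have hN := pos_INR (n ^ k.-1); move: (INR (n ^ k.-1)) hN hP => N hN hP.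
    have h3 : (INR C * N <= mu * INR n * N)%real by apply: Rmult_le_compat_r.
    have h4 : (mu * INR n * N <= INR D * (mu * INR n * N))%real.
      rewrite -{1}[(mu * INR n * N)%real]Rmult_1_l; apply: Rmult_le_compat_r; last lra.
      by apply: Rmult_le_pos => //; apply: Rmult_le_pos; [lra | apply: pos_INR].
    apply: (Rmult_le_reg_l (INR D)); first lra.
    have -> : (INR D * (/ INR D * rP - mu * (INR n * N)) = rP - INR D * (mu * INR n * N))%real.
      by field; lra.
    lra.
  - move=> S cS; rewrite card_ord; have h := F1 S cS.
    have : n <= K * #|[set e in side_edges k s F | S \subset e]|.
      apply: (@leq_trans (K * (n %/ K).+1)); last by rewrite leq_mul2l h orbT.
      by rewrite mulnC ltnW // ltn_ceil // ltnW.
    move/INR_leq; rewrite (mult_INR K) => h2.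
    apply: (Rmult_le_reg_l (INR K)); first lra.
    by rewrite -Rmult_assoc Rinv_r ?Rmult_1_l //; lra.
  - by rewrite card_ord.
  - by rewrite card_ord dvdn_mulr.
move/(factor_side hd); rewrite cs /w dvdn_addr ?/x ?dvdn_mulr // dvdn1.
by rewrite (negPf d1).
Qed.

End CompletePartite.

Theorem mainTheorem7 (k : nat) (hk : 3 <= k) :
  (forall (VF : finType) (EF : {set {set VF}}),
     uniform k EF -> kpartite k EF -> gcdS k EF = 1 -> FACTOR k EF) /\
  (forall a : 'I_k -> nat, (forall i, 0 < a i) ->
     (FACTOR k (Kedges a) <-> gcdS k (Kedges a) = 1)).
Proof.
split=> [VF EF _|a ha]; first exact: FACTOR_of_gcdS (ltnW hk).
split; first exact: gcdS_of_FACTOR.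
apply: FACTOR_of_gcdS (ltnW hk) _; exists [ffun x => tag x]; exact: realisation_tag.
Qed.
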